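(* Let $\theta$ be an inner function and let $G=\begin{pmatrix}g_{11}&g_{12}\\ g_{21}&g_{22}\end{pmatrix}$ have each entry in $L^\infty(\mathbb{T})$. Then $\ker A_G^\theta$ is a nearly $S^*$-invariant subspace of $H^2(\mathbb{D},\mathbb{C}^2)$ with defect $2$.
   Context: $H^2$ is the Hardy space of the unit disc $\mathbb{D}$, identified with its boundary functions in $L^2=L^2(\mathbb{T})$, and $H^2(\mathbb{D},\mathbb{C}^2)$ is the space of column vectors of length 2 with entries in $H^2$. $\overline{H^2_0} = \{\overline f : f\in H^2, f(0)=0\}$, $K_\theta=\theta\overline{H^2_0}\cap H^2$, and $P_\theta:L^2\to K_\theta$ is the orthogonal projection. $K_\theta(\mathbb{D},\mathbb{C}^2)\subseteq H^2(\mathbb{D},\mathbb{C}^2)$ is the space of vectors of length 2 with both coordinates in $K_\theta$. The truncated Toeplitz operator $A_G^\theta$ on $K_\theta(\mathbb{D},\mathbb{C}^2)$ is $A_G^\theta F = P_\theta(GF)$, with $P_\theta$ applied coordinatewise. The backward shift is $S^*F(z)=(F(z)-F(0))/z$ (entrywise). A closed subspace $M\subseteq H^2(\mathbb{D},\mathbb{C}^n)$ is nearly $S^*$-invariant with defect $m$ if there is an $m$-dimensional subspace $D$ (which may be taken orthogonal to $M$) such that $S^*F\in M\oplus D$ whenever $F\in M$ and $F(0)=0$. *)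

(* Defs.v *)
From HB Require Import structures.
From mathcomp Require Import all_boot all_order all_algebra.
From mathcomp Require Import complex.
From mathcomp Require Import all_classical all_reals all_analysis.

Set Implicit Arguments.
Unset Strict Implicit.
Unset Printing Implicit Defensive.
Import Order.TTheory GRing.Theory Num.Theory.
Import numFieldNormedType.Exports.
Local Open Scope classical_set_scope.
Local Open Scope ring_scope.
Local Open Scope complex_scope.

(* The circle is parametrized by t |-> exp(it): a function on the circle is a
   function R -> R[i] (or R -> 'cV[R[i]]_n), where only the values on
   [0, 2 pi] matter.  Spaces of (classes of) functions are sets of
   representatives, and equality of elements is equality almost everywhere for
   the normalized arc-length measure [circle]. *)

Lemma twopi_gt0 (R : realType) : (0 : R) < 2 * pi.
Proof. by rewrite mulr_gt0 // pi_gt0. Qed.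

Definition circle (R : realType) : probability (measurableTypeR R) R :=
  uniform_prob (twopi_gt0 R).

Section HardySpace.
Context {R : realType}.
Local Notation C := R[i].
Local Notation normc := (@ComplexField.Normc.normc R).
Local Notation mT := (circle R).
Implicit Types (f g theta : R -> C) (F Theta : C -> C).

Definition cexpi (t : R) : C := cos t +i* sin t.

Definition cmeasurable f : Prop :=
  measurable_fun setT (fun t => complex.Re (f t)) /\
  measurable_fun setT (fun t => complex.Im (f t)).

Definition L2norm f : \bar R := 'N[mT]_2%:E[EFin \o (fun t => normc (f t))]%E.

Definition Linfnorm f : \bar R := 'N[mT]_+oo[EFin \o (fun t => normc (f t))]%E.

Definition L2 : set (R -> C) := [set f | cmeasurable f /\ (L2norm f < +oo)%E].

Definition Linf : set (R -> C) :=
  [set f | cmeasurable f /\ (Linfnorm f < +oo)%E].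

Definition cintegral f : C :=
  (\int[mT]_t complex.Re (f t))%R +i* (\int[mT]_t complex.Im (f t))%R.

Definition L2inner f g : C := cintegral (fun t => f t * conjc (g t)).

(* R[i] carries its topology through the alias R[i]^o *)
Definition taylor (a : nat -> C) F : Prop :=
  forall z : C, normc z < 1 ->
    (fun n => (\sum_(k < n) a k * z ^+ k : C^o)) @ \oo --> (F z : C^o).

(* only the values on the open unit disc matter *)
Definition hardy2_disc : set (C -> C) :=
  [set F | exists2 a : nat -> C,
     cvgn (series (fun k => normc (a k) ^+ 2)) & taylor a F].

Definition hardyinf_disc : set (C -> C) :=
  [set F | (exists a : nat -> C, taylor a F) /\
     exists B : R, forall z : C, normc z < 1 -> normc (F z) <= B].

(* f is the boundary function of F: the L^2-limit of the dilates F(r e^{it})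
   as r tends to 1 from the left *)
Definition boundary_function F f : Prop :=
  L2 f /\
  L2norm (fun t => F (r%:C * cexpi t) - f t) @[r --> (1 : R)^'-] --> 0%E.

Definition H2 : set (R -> C) :=
  [set f | exists2 F, hardy2_disc F & boundary_function F f].

(* the function on the disc with boundary function f, for f in H2 *)
Definition disc_function f : C -> C :=
  xget (fun=> 0) [set F | hardy2_disc F /\ boundary_function F f].

Definition at0 f : C := disc_function f 0.

Definition inner_function theta : Prop :=
  (exists2 Theta, hardyinf_disc Theta & boundary_function Theta theta) /\
  {ae mT, forall t, normc (theta t) = 1}.

Definition model_space theta : set (R -> C) :=
  [set f | H2 f /\
     exists h, [/\ H2 h, at0 h = 0
                 & {ae mT, forall t, f t = theta t * conjc (h t)}]].

Definition orth_proj (V : set (R -> C)) f : R -> C :=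
  xget (fun=> 0)
    [set p | V p /\ forall k, V k -> L2inner (fun t => f t - p t) k = 0].

Section Vector.
Variable n : nat.
Local Notation vfun := (R -> 'cV[C]_n).
Implicit Types (X Y : vfun) (M D : set vfun).

Definition coord X (i : 'I_n) : R -> C := fun t => X t i 0.

Definition vec_of (V : set (R -> C)) : set vfun :=
  [set X | forall i, V (coord X i)].

Definition vinner X Y : C := \sum_(i < n) L2inner (coord X i) (coord Y i).

Definition vcvg (u : nat -> vfun) X : Prop :=
  forall i, L2norm (fun t => coord (u k) i t - coord X i t) @[k --> \oo] --> 0%E.

Definition vat0 X : 'cV[C]_n := \col_i at0 (coord X i).

(* (F(z) - F(0)) / z on the circle *)
Definition backward_shift X : vfun :=
  fun t => (cexpi t)^-1 *: (X t - vat0 X).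

Definition closed_subspace M : Prop :=
  [/\ M `<=` vec_of H2,
      M (fun=> 0),
      forall (c : C) X Y, M X -> M Y -> M (fun t => c *: X t + Y t)
    & forall (u : nat -> vfun) X,
        (forall k, M (u k)) -> vec_of L2 X -> vcvg u X -> M X].

Definition has_dim (m : nat) D : Prop :=
  exists u : 'I_m -> vfun,
    [/\ forall j, vec_of H2 (u j),
        forall c : 'I_m -> C,
          {ae mT, forall t, \sum_(j < m) c j *: u j t = 0} ->
          forall j, c j = 0
      & D = [set X | vec_of H2 X /\ exists c : 'I_m -> C,
               {ae mT, forall t, X t = \sum_(j < m) c j *: u j t}]].

Definition nearly_invariant_with_defect (m : nat) M : Prop :=
  closed_subspace M /\
  exists D, [/\ has_dim m D,
      forall X Y, M X -> D Y -> vinner X Y = 0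
    & forall X, M X -> vat0 X = 0 ->
        exists Y Z, [/\ M Y, D Z
          & {ae mT, forall t, backward_shift X t = Y t + Z t}]].

Definition truncated_toeplitz theta (G : R -> 'M[C]_n) X : vfun :=
  fun t => \col_i
    orth_proj (model_space theta) (coord (fun s => G s *m X s) i) t.

Definition ker_truncated_toeplitz theta (G : R -> 'M[C]_n) : set vfun :=
  [set X | vec_of (model_space theta) X /\
     {ae mT, forall t, truncated_toeplitz theta G X t = 0}].

End Vector.

End HardySpace.

(* Main.v *)
From mathcomp Require Import all_boot all_order all_algebra.
From mathcomp Require Import complex.
From mathcomp Require Import all_classical all_reals all_analysis.
From mathcomp Require Import measurable_realfun ess_sup_inf.
From mathcomp Require Import ring lra.
Require Import Defs.

(** The kernel [M] of a truncated Toeplitz operator consists of the vectors [X]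
    with coordinates in the model space [K] such that every coordinate of [G X]
    is orthogonal to [K].  Suppose [X] is in [M] and vanishes at 0.  Its backward
    shift is multiplication by [conj z] on the circle, it stays in [K]
    ([model_space_backshift]), and
    [<G (conj z X), k> = <G X, z k>], which is 0 as soon as [z k] is again in [K].
    On the circle [K] is invariant under the conjugation [k |-> theta conj k]
    ([twist]); under it multiplication by [z] becomes a backward shift, so [z k]
    stays in [K] as soon as one conjugate-linear functional, [exit_functional],
    vanishes at [k] ([model_space_shift]).  (That functional is the pairing with
    the classical vector [S^* theta] of [K].)  So the backward shift of [X] lies
    in the larger space [almost_kernel], which only asks each coordinate of [G X]
    to be orthogonal to a subspace of codimension at most one in [K].  One scalar
    condition per coordinate, the pairing with a fixed vector [k1], then cuts
    [M] out of [almost_kernel] ([almost_kernel_ker]): the orthogonal complement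
    of [M] in it has dimension at most [n] for an [n x n] symbol.

    The defect space must have dimension exactly [n].  [triangular_complement]
    chooses its basis one scalar condition at a time: a vector of the complement
    that fulfils the earlier conditions and on which the next one takes the value
    1, or, if there is none, [theta] times a coordinate vector, which is
    orthogonal to all vectors over [K].

    What remains is the Hilbert space theory of the circle.  Orthogonal
    projections, onto [K] to make sense of the operator and onto [M] to split
    vectors, come from [hilbert_projection] and the completeness of L2
    ([L2_complete]: a rapidly Cauchy subsequence converges almost everywhere, and
    Fatou's lemma does the rest).  Boundary functions are handled through [H2P]:
    a function is in [H2] if and only if it is an L2-limit of analytic
    polynomials.  One direction truncates the Taylor series of a dilate; the
    other one sums the Fourier coefficients and uses that dilation is a
    contraction on polynomials.  Closedness of [H2], its stability under shifts,
    and the equality of the value at 0 with the mean ([at0E]) follow from the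
    same approximations. *)

Import Order.TTheory GRing.Theory Num.Theory.
Import numFieldNormedType.Exports.
Local Open Scope classical_set_scope.
Local Open Scope ring_scope.
Local Open Scope complex_scope.

Set Implicit Arguments.
Unset Strict Implicit.
Unset Printing Implicit Defensive.

Local Notation Re := complex.Re.
Local Notation Im := complex.Im.
Local Notation normc := ComplexField.Normc.normc.

(** * Complex numbers *)

Section ComplexNumbers.
Variable R : rcfType.
Implicit Types z w : R[i].

Lemma normc_ge0 z : 0 <= normc z.
Proof. by case: z => a b; exact: sqrtr_ge0. Qed.

Lemma normc_sqrE z : normc z ^+ 2 = Re z ^+ 2 + Im z ^+ 2.
Proof. by case: z => a b; rewrite /= sqr_sqrtr // addr_ge0 // sqr_ge0. Qed.

Lemma Re_add z w : Re (z + w) = Re z + Re w.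
Proof. by case: z; case: w. Qed.

Lemma Im_add z w : Im (z + w) = Im z + Im w.
Proof. by case: z; case: w. Qed.

Lemma Re_mul z w : Re (z * w) = Re z * Re w - Im z * Im w.
Proof. by case: z; case: w. Qed.

Lemma Im_mul z w : Im (z * w) = Re z * Im w + Im z * Re w.
Proof. by case: z; case: w. Qed.

Lemma Re_conj z : Re (conjc z) = Re z.
Proof. by case: z. Qed.

Lemma Im_conj z : Im (conjc z) = - Im z.
Proof. by case: z. Qed.

Lemma Re_opp z : Re (- z) = - Re z.
Proof. by case: z. Qed.

Lemma Im_opp z : Im (- z) = - Im z.
Proof. by case: z. Qed.

(** Rewriting rules that compute real and imaginary parts. *)
Definition ReImE := (Re_add, Im_add, Re_mul, Im_mul, Re_conj, Im_conj,
  Re_opp, Im_opp).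

Lemma complex_ext z w : Re z = Re w -> Im z = Im w -> z = w.
Proof. by case: z w => [a b] [c d] /= -> ->. Qed.

Lemma conjcD z w : conjc (z + w) = conjc z + conjc w.
Proof. exact: rmorphD. Qed.

Lemma conjcM z w : conjc (z * w) = conjc z * conjc w.
Proof. exact: rmorphM. Qed.

Lemma mulr_conjc z : z * conjc z = (normc z ^+ 2)%:C.
Proof.
by rewrite normc_sqrE; apply: complex_ext; rewrite !ReImE /=; ring.
Qed.

Lemma normc_conj z : normc (conjc z) = normc z.
Proof. by case: z => a b /=; rewrite sqrrN. Qed.

Lemma normc_real (x : R) : normc x%:C = `|x|.
Proof. by rewrite /= expr0n addr0 sqrtr_sqr. Qed.

Lemma normcX z n : normc (z ^+ n) = normc z ^+ n.
Proof.
elim: n => [|n IH]; first by rewrite !expr0 (ComplexField.Normc.normc1 R).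
by rewrite !exprS ComplexField.Normc.normcM IH.
Qed.

Lemma normr_normc z : `|z| = (normc z)%:C.
Proof. by case: z. Qed.

End ComplexNumbers.

(** * Pre-Hilbert spaces *)

(** An inner product is only required on a subspace [L] of a module of functions:
    the integral that defines it is meaningless outside, and two functions that
    agree almost everywhere need not be equal, so [ip x x = 0] does not force
    [x = 0]. *)
Record prehilbert (R : rcfType) (E : lmodType R[i]) (L : set E)
    (ip : E -> E -> R[i]) : Prop := PreHilbert {
  ph_lin : forall c x y, L x -> L y -> L (c *: x + y);
  ip_lin : forall c x y z, L x -> L y -> L z ->
    ip (c *: x + y) z = c * ip x z + ip y z;
  ip_conj : forall x y, L x -> L y -> ip y x = conjc (ip x y);
  ip_ge0 : forall x, L x -> 0 <= ip x x }.

Section PreHilbert.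
Variables (R : realType) (E : lmodType R[i]) (L : set E) (ip : E -> E -> R[i]).
Hypothesis H : prehilbert L ip.
Implicit Types (x y z : E) (c : R[i]).

Definition sqn x : R := Re (ip x x).

Lemma ph_sub x y : L x -> L y -> L (x - y).
Proof. by move=> Lx Ly; rewrite addrC -scaleN1r; exact: (ph_lin H). Qed.

Lemma ph0 x : L x -> L 0.
Proof. by move=> Lx; rewrite -(subrr x); exact: ph_sub. Qed.

Lemma ph_scale c x : L x -> L (c *: x).
Proof.
by move=> Lx; rewrite -[_ *: _]addr0; apply: (ph_lin H) => //; exact: ph0 Lx.
Qed.

Lemma ph_add x y : L x -> L y -> L (x + y).
Proof. by move=> Lx Ly; rewrite -[x]scale1r; exact: (ph_lin H). Qed.

Lemma ip_linr c x y z : L x -> L y -> L z ->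
  ip z (c *: x + y) = conjc c * ip z x + ip z y.
Proof.
move=> Lx Ly Lz; rewrite (ip_conj H _ Lz); last exact: (ph_lin H).
by rewrite (ip_lin H) // rmorphD rmorphM /= -!(ip_conj H).
Qed.

Lemma ip_sub x y z : L x -> L y -> L z -> ip (x - y) z = ip x z - ip y z.
Proof.
move=> Lx Ly Lz.
by rewrite addrC -scaleN1r (ip_lin H) // mulN1r addrC.
Qed.

Lemma ip_subr x y z : L x -> L y -> L z -> ip z (x - y) = ip z x - ip z y.
Proof.
move=> Lx Ly Lz.
by rewrite addrC -scaleN1r ip_linr // rmorphN rmorph1 mulN1r addrC.
Qed.

Lemma ip_scale c x z : L x -> L z -> ip (c *: x) z = c * ip x z.
Proof.
move=> Lx Lz; have L0 := ph0 Lx.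
have ip0 : ip 0 z = 0 by rewrite -(subrr x) ip_sub // subrr.
by rewrite -[_ *: _]addr0 (ip_lin H) // ip0 addr0.
Qed.

Lemma sqn_ge0 x : L x -> 0 <= sqn x.
Proof. by move=> /(ip_ge0 H); rewrite lecE => /andP[]. Qed.

Lemma ip_sqn x : L x -> ip x x = (sqn x)%:C.
Proof.
move=> /(ip_ge0 H); rewrite lecE => /andP[/eqP i0 _].
by apply: complex_ext.
Qed.

Lemma sqnD c x y : L x -> L y ->
  sqn (c *: x + y) =
  normc c ^+ 2 * sqn x + 2 * Re (c * ip x y) + sqn y.
Proof.
move=> Lx Ly; have Lxy := ph_lin H c Lx Ly.
rewrite /sqn (ip_lin H) // !ip_linr // (ip_sqn Lx) (ip_sqn Ly).
rewrite (ip_conj H Lx Ly) normc_sqrE !ReImE /=; ring.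
Qed.

Lemma sqnB x y : L x -> L y ->
  sqn (x - y) = sqn x - 2 * Re (ip x y) + sqn y.
Proof.
move=> Lx Ly; rewrite addrC -scaleN1r sqnD //.
rewrite (ip_conj H Lx Ly) normc_sqrE !ReImE /=; ring.
Qed.

Lemma sqnZ c x : L x -> sqn (c *: x) = normc c ^+ 2 * sqn x.
Proof.
move=> Lx; rewrite /sqn ip_scale //; last exact: ph_scale.
rewrite (ip_conj H _ Lx); last exact: ph_scale.
by rewrite ip_scale // (ip_sqn Lx) normc_sqrE !ReImE /=; ring.
Qed.

Lemma sqnN x y : L x -> L y -> sqn (x - y) = sqn (y - x).
Proof.
move=> Lx Ly; rewrite !sqnB // (ip_conj H Lx Ly) Re_conj; ring.
Qed.

Lemma parallelogram x y : L x -> L y ->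
  sqn (x + y) + sqn (x - y) = 2 * sqn x + 2 * sqn y.
Proof.
move=> Lx Ly; rewrite sqnB // -[x in x + y]scale1r sqnD //.
by rewrite normc_sqrE !ReImE /=; ring.
Qed.

(** Triangle inequality for squared norms: with the constant 2 it needs no square
    roots, and limits do not see the constant. *)
Lemma sqn_quasi x y z : L x -> L y -> L z ->
  sqn (x - z) <= 2 * sqn (x - y) + 2 * sqn (y - z).
Proof.
move=> Lx Ly Lz; have Lxy := ph_sub Lx Ly; have Lyz := ph_sub Ly Lz.
rewrite -parallelogram // addrA subrK lerDl; apply: sqn_ge0.
exact: ph_sub.
Qed.

(** Positivity of the norm of [c *: x + y] for [c] a real multiple of the
    conjugate of [ip x y]; degenerate vectors need a separate case because the
    form is not definite. *)
Lemma cauchy_schwarz x y : L x -> L y ->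
  normc (ip x y) ^+ 2 <= sqn x * sqn y.
Proof.
move=> Lx Ly.
have key c : 0 <= normc c ^+ 2 * sqn x + 2 * Re (c * ip x y) + sqn y.
  by rewrite -sqnD //; apply: sqn_ge0; exact: (ph_lin H).
have sx := sqn_ge0 Lx; have sy := sqn_ge0 Ly.
have {}key (t : R) :
    0 <= t ^+ 2 * normc (ip x y) ^+ 2 * sqn x
         - 2 * t * normc (ip x y) ^+ 2 + sqn y.
  have := key (- t%:C * conjc (ip x y)).
  rewrite !normc_sqrE !ReImE /=; congr (_ <= _); ring.
set a := normc (ip x y) ^+ 2 in key *.
have a0 : 0 <= a by exact: sqr_ge0.
have [x0|x0] := eqVneq (sqn x) 0.
  (* a quadratic in t without t^2 term that stays nonnegative has no t term *)
  rewrite x0 mul0r; rewrite leNgt; apply/negP => agt0.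
  have := key ((sqn y + 1) / (2 * a)).
  rewrite x0 mulr0 add0r.
  have -> : 2 * ((sqn y + 1) / (2 * a)) * a = sqn y + 1 by field; rewrite gt_eqF.
  lra.
have sx0 : 0 < sqn x by rewrite lt_def x0.
have := key (sqn x)^-1.
have -> : (sqn x)^-1 ^+ 2 * a * sqn x - 2 * (sqn x)^-1 * a = - (a / sqn x).
  by field.
by rewrite addrC subr_ge0 ler_pdivrMr // mulrC.
Qed.

Lemma cvg_ip (u : nat -> E) x y : (forall k, L (u k)) -> L x -> L y ->
  sqn (u k - x) @[k --> \oo] --> 0 ->
  normc (ip (u k) y - ip x y) ^+ 2 @[k --> \oo] --> 0.
Proof.
move=> Lu Lx Ly ux.
apply: (@squeeze_cvgr _ _ _ _ (fun=> 0) (fun k => sqn (u k - x) * sqn y)).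
- near=> k; rewrite sqr_ge0 -ip_sub // cauchy_schwarz //.
  exact: ph_sub.
- exact: cvg_cst.
- by rewrite -(mul0r (sqn y)); apply: cvgMl.
Unshelve. all: by end_near. Qed.

End PreHilbert.

Definition sqn_complete (R : realType) (E : lmodType R[i]) (L : set E)
    (ip : E -> E -> R[i]) : Prop :=
  forall u : nat -> E, (forall k, L (u k)) ->
    (forall e, 0 < e -> exists N, forall k l, (N <= k)%N -> (N <= l)%N ->
      sqn ip (u k - u l) < e) ->
    exists2 x, L x & sqn ip (u k - x) @[k --> \oo] --> 0.

(** * Orthogonal projections *)

Section Projection.
Variables (R : realType) (E : lmodType R[i]) (L : set E) (ip : E -> E -> R[i]).
Hypothesis H : prehilbert L ip.
Variable V : set E.
Hypothesis VL : V `<=` L.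
Hypothesis V0 : V !=set0.
Hypothesis V_lin : forall c x y, V x -> V y -> V (c *: x + y).

Let dist x := inf [set sqn ip (x - v) | v in V].

Let dist_has_inf x : L x -> has_inf [set sqn ip (x - v) | v in V].
Proof.
move=> Lx; split; first by case: V0 => v Vv; exists (sqn ip (x - v)), v.
exists 0 => _ [v Vv <-]; apply: (sqn_ge0 H); apply: (ph_sub H) => //.
exact: VL.
Qed.

Let dist_le x v : L x -> V v -> dist x <= sqn ip (x - v).
Proof.
by move=> Lx Vv; apply: ge_inf; [exact: (dist_has_inf Lx).2 | exists v].
Qed.

(** A well chosen step along [v] brings [p] closer to [x], and the gain grows with
    the component of [x - p] along [v]; but it cannot exceed [e]. *)
Lemma almost_closest_orth x p v e : L x -> V p -> V v ->
  sqn ip (x - p) <= dist x + e ->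
  normc (ip (x - p) v) ^+ 2 <= (sqn ip v + 1) * e.
Proof.
move=> Lx Vp Vv pe; have Lw := ph_sub H Lx (VL Vp).
set w := x - p in Lw pe *; set s := sqn ip v.
have s0 : 0 <= s by apply: (sqn_ge0 H); exact: VL.
set a := normc _ ^+ 2.
(* s + 1 stands for the squared norm of v, which may vanish *)
pose c := - ((s + 1)^-1)%:C * ip w v.
have : dist x <= sqn ip (c *: v + w).
  have -> : c *: v + w = x - ((- c) *: v + p).
    by rewrite /w opprD scaleNr opprK addrA addrAC addrC addrA.
  by apply: dist_le => //; exact: V_lin.
rewrite (sqnD H _ (VL Vv) Lw) (ip_conj H Lw (VL Vv)).
have -> : 2 * Re (c * conjc (ip w v)) = - 2 * (s + 1)^-1 * a.
  by rewrite /c /a normc_sqrE !ReImE /=; ring.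
have -> : normc c ^+ 2 = (s + 1)^-1 ^+ 2 * a.
  by rewrite /c /a !normc_sqrE !ReImE /=; ring.
move=> dle.
have : 0 <= (s + 1)^-1 ^+ 2 * a * s - 2 * (s + 1)^-1 * a + e by rewrite -/s in dle; lra.
have s1 : 0 < s + 1 by lra.
rewrite -(pmulr_rge0 _ (exprn_gt0 2 s1)).
have -> : (s + 1) ^+ 2 * ((s + 1)^-1 ^+ 2 * a * s - 2 * (s + 1)^-1 * a + e)
   = (s + 1) * ((s + 1) * e - a) - a by field; rewrite gt_eqF.
have a0 : 0 <= a by exact: sqr_ge0.
move=> h; have : 0 <= (s + 1) * ((s + 1) * e - a) by lra.
by rewrite pmulr_rge0 // subr_ge0.
Qed.

(** The midpoint of two almost closest points is not closer than the distance, so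
    the parallelogram identity makes minimizing sequences Cauchy. *)
Lemma almost_closest_near x p q e : L x -> V p -> V q ->
  sqn ip (x - p) <= dist x + e -> sqn ip (x - q) <= dist x + e ->
  sqn ip (p - q) <= 4 * e.
Proof.
move=> Lx Vp Vq pe qe.
have Lp := ph_sub H Lx (VL Vp); have Lq := ph_sub H Lx (VL Vq).
have := parallelogram H Lp Lq.
have -> : x - p - (x - q) = q - p by rewrite opprB addrC addrA subrK.
have -> : x - p + (x - q) = (2 : R[i]) *: (x - 2^-1 *: (p + q)).
  rewrite scalerBr scalerA mulfV ?pnatr_eq0 // scale1r scaler_nat mulr2n opprD.
  by rewrite addrACA.
have Vm : V (2^-1 *: (p + q)).
  rewrite scalerDr; apply: V_lin => //.
  have [w Vw] := V0; have V0' : V 0 by rewrite -(addNr w) -scaleN1r; exact: V_lin.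
  by rewrite -[_ *: _]addr0; exact: V_lin.
have Lm := ph_sub H Lx (VL Vm).
rewrite (sqnZ H _ Lm) (sqnN H (VL Vq) (VL Vp)).
have -> : normc (2 : R[i]) ^+ 2 = 4.
  by rewrite normc_sqrE /= ; ring.
have := dist_le Lx Vm; lra.
Qed.

Hypothesis Lcomplete : sqn_complete L ip.
Hypothesis V_closed : forall (u : nat -> E) x, (forall k, V (u k)) -> L x ->
  sqn ip (u k - x) @[k --> \oo] --> 0 -> V x.

(** The limit of a minimizing sequence is orthogonal to [V] because the components
    of [x - u k] along [v] tend to 0. *)
Theorem hilbert_projection x : L x ->
  exists2 p, V p & forall v, V v -> ip (x - p) v = 0.
Proof.
move=> Lx.
have /choice[u uP] (k : nat) :
    exists v, V v /\ sqn ip (x - v) <= dist x + k.+1%:R^-1.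
  have k0 : 0 < k.+1%:R^-1 :> R by rewrite invr_gt0.
  have [_ [v Vv <-] /ltW vk] := inf_adherent k0 (dist_has_inf Lx).
  by exists v.
have Vu k : V (u k) by case: (uP k).
have Lu k : L (u k) by exact: VL.
have uk N k : (N <= k)%N -> sqn ip (x - u k) <= dist x + N.+1%:R^-1.
  move=> Nk; apply: le_trans (uP k).2 _.
  by rewrite lerD2l lef_pV2 ?posrE // ler_nat.
have [p Lp up] : exists2 p, L p & sqn ip (u k - p) @[k --> \oo] --> 0.
  apply: Lcomplete => // e e0.
  have [N _ /(_ N (leqnn N)) /= Ne] := near_infty_natSinv_lt (PosNum (divr_gt0 e0 (ltr0n R 4))).
  exists N => k l Nk Nl; apply: (@le_lt_trans _ _ (4 * N.+1%:R^-1)).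
    by apply: (almost_closest_near (x := x)) => //; exact: uk.
  by rewrite mulrC -ltr_pdivlMr.
have Vp : V p by exact: V_closed up.
exists p => // v Vv; have Lv := VL Vv.
apply: ComplexField.Normc.eq0_normc; apply/eqP; rewrite -sqrf_eq0; apply/eqP.
pose b k := 2 * ((sqn ip v + 1) * k.+1%:R^-1)
  + 2 * normc (ip (u k) v - ip p v) ^+ 2.
have b0 : b k @[k --> \oo] --> 0.
  have <- : 2 * ((sqn ip v + 1) * 0) + 2 * 0 = 0 :> R by rewrite !mulr0 addr0.
  apply: cvgD; apply: cvgMr; first by apply: cvgMr; exact: cvg_harmonic.
  exact: (cvg_ip H Lu Lp Lv up).
apply/eqP; rewrite eq_le sqr_ge0 andbT.
apply: (cvgr_to_ge b0); near=> k.
have := almost_closest_orth Lx (Vu k) Vv (uP k).2.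
set y := ip (x - u k) v; set z := ip (u k) v - ip p v.
have -> : ip (x - p) v = y + z.
  by rewrite /y /z -(ip_sub H) // -[LHS]/(ip (x - p) v) !(ip_sub H) // addrA subrK.
rewrite /b -/z; set m := (sqn ip v + 1) * _.
clearbody y z m; rewrite !normc_sqrE !ReImE => h.
have := sqr_ge0 (Re y - Re z); have := sqr_ge0 (Im y - Im z).
rewrite !sqrrB !sqrrD; lra.
Unshelve. all: by end_near. Qed.

End Projection.
(** * Complements of finite codimension *)

Section FiniteCodimension.
Variables (R : realType) (E : lmodType R[i]) (L : set E) (ip : E -> E -> R[i]).
Hypothesis H : prehilbert L ip.

Lemma ph_sum n (c : 'I_n -> R[i]) (u : 'I_n -> E) (v : E) : L v ->
  (forall j, L (u j)) -> L (\sum_(j < n) c j *: u j).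
Proof.
move=> Lv Lu; elim/big_ind: _ => [|x y Lx Ly|j _].
- exact: (ph0 H Lv).
- exact: (ph_add H).
- exact: (ph_scale H).
Qed.

Lemma ip_sum n (c : 'I_n -> R[i]) (u : 'I_n -> E) (z : E) : L z ->
  (forall j, L (u j)) ->
  ip (\sum_(j < n) c j *: u j) z = \sum_(j < n) c j * ip (u j) z.
Proof.
move=> Lz Lu.
suff : L (\sum_(j < n) c j *: u j) /\
  ip (\sum_(j < n) c j *: u j) z = \sum_(j < n) c j * ip (u j) z by case.
elim/big_ind2: _ => [|x a y b [Lx xa] [Ly yb]|j _].
- split; first exact: (ph0 H Lz).
  by rewrite -[0 in LHS](subrr z) (ip_sub H) // subrr.
- split; first exact: (ph_add H).
  by have := ip_lin H 1 Lx Ly Lz; rewrite scale1r mul1r xa yb.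
- by split; [exact: (ph_scale H) | exact: (ip_scale H)].
Qed.

(** Let the functionals [ip _ (z i)] cut out a subspace of [W].  Then [n] vectors
    span a complement; they are made independent by replacing the superfluous
    ones by the orthonormal vectors [e j], which are orthogonal to [W].  The
    matrix of the functionals at the vectors taken from [W] is unitriangular:
    this gives both the independence and the elimination in the last clause. *)
Lemma triangular_complement n (W : set E) (z e : 'I_n -> E) :
  W `<=` L -> W !=set0 ->
  (forall c x y, W x -> W y -> W (c *: x + y)) ->
  (forall j, L (z j)) -> (forall j, L (e j)) ->
  (forall i j, ip (e i) (e j) = (i == j)%:R) ->
  (forall x j, W x -> ip x (e j) = 0) ->
  exists u : 'I_n -> E,
    [/\ forall j, W (u j) \/ u j = e j,
        forall c, (forall v, L v -> ip (\sum_(j < n) c j *: u j) v = 0) ->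
          forall j, c j = 0
      & forall w, W w -> exists c, W (w - \sum_(j < n) c j *: u j) /\
          forall i, ip (w - \sum_(j < n) c j *: u j) (z i) = 0].
Proof.
move=> WL W0 Wlin Lz Le eon We.
pose A j x := [/\ W x, ip x (z j) = 1 &
  forall i : 'I_n, (i < j)%N -> ip x (z i) = 0].
pose B (j : 'I_n) := forall x, W x -> (forall i : 'I_n, (i < j)%N -> ip x (z i) = 0) ->
  ip x (z j) = 0.
have /choice[u uP] (j : 'I_n) : exists x, A j x \/ (x = e j /\ B j).
  have [[x Ax]|nA] := pselect (exists x, A j x); first by exists x; left.
  exists (e j); right; split => // x Wx xz; apply: contrapT => /eqP xj.
  apply: nA; exists ((ip x (z j))^-1 *: x); have Lx := WL _ Wx.
  have [w Ww] := W0; have W00 : W 0 by rewrite -(addNr w) -scaleN1r; exact: Wlin.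
  split.
  - by rewrite -[_ *: _]addr0; exact: Wlin.
  - by rewrite (ip_scale H) // mulVf.
  - by move=> i ij; rewrite (ip_scale H) // (xz _ ij) mulr0.
have Lu j : L (u j) by case: (uP j) => [[/WL]|[-> _]].
exists u; split.
- by move=> j; case: (uP j) => [[]|[]]; [left | right].
- move=> c c0.
  have cB j : u j = e j -> B j -> c j = 0.
    move=> uj Bj; have := c0 (e j) (Le j); rewrite ip_sum // (bigD1 j) //=.
    rewrite uj eon eqxx mulr1 big1 ?addr0 // => i ij.
    case: (uP i) => [[Wi _ _]|[-> _]]; first by rewrite We // mulr0.
    by rewrite eon (negbTE ij) mulr0.
  suff key m : forall j : 'I_n, (j < m)%N -> c j = 0 by move=> j; exact: (key n).
  elim: m => // m IH j; rewrite ltnS leq_eqVlt => /orP[/eqP jm|]; last exact: IH.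
  have [[Wj uj1 _]|[uj Bj]] := uP j; last exact: cB.
  have := c0 (z j) (Lz j); rewrite ip_sum // (bigD1 j) //=.
  rewrite uj1 mulr1 big1 ?addr0 // => i ij.
  have [ltij|] := ltnP i j; first by rewrite IH ?mul0r // -jm.
  rewrite leq_eqVlt => /orP[/eqP ji|ltji].
    by move: ij; rewrite -(inj_eq val_inj) /= -ji eqxx.
  have [[_ _ ui]|[ui Bi]] := uP i; first by rewrite ui // mulr0.
  by rewrite (cB i) // mul0r.
- move=> w Ww.
  suff key m : (m <= n)%N -> exists c, W (w - \sum_(j < n) c j *: u j) /\
      forall i : 'I_n, (i < m)%N -> ip (w - \sum_(j < n) c j *: u j) (z i) = 0.
    by have [c [Wc ci]] := key n (leqnn n); exists c; split=> // i; exact: ci.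
  elim: m => [_|m IH mn].
    exists (fun=> 0); rewrite big1 ?subr0 // => j _; exact: scale0r.
  have [c [Wr rz]] := IH (ltnW mn); pose j := Ordinal mn.
  set r := w - _ in Wr rz; have Lr := WL _ Wr.
  have [[Wj uj1 uj0]|[uj Bj]] := uP j; last first.
    exists c; split=> // i; rewrite ltnS leq_eqVlt => /orP[/eqP im|]; last exact: rz.
    by have -> : i = j by [exact: val_inj]; exact: Bj.
  set a := ip r (z j).
  exists (fun i => c i + (i == j)%:R * a).
  have -> : w - \sum_(i < n) (c i + (i == j)%:R * a) *: u i = - a *: u j + r.
    under eq_bigr do rewrite scalerDl.
    rewrite big_split /= opprD addrA -/r addrC scaleNr; congr (- _ + _).
    rewrite (bigD1 j) //= eqxx mul1r big1 ?addr0 // => i /negbTE ->.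
    by rewrite mul0r scale0r.
  split; first exact: Wlin.
  move=> i; rewrite ltnS leq_eqVlt (ip_lin H) // => /orP[/eqP im|im].
    by have -> : i = j by [exact: val_inj]; rewrite uj1 mulr1 addNr.
  by rewrite uj0 // mulr0 add0r rz.
Qed.

End FiniteCodimension.
(** * Square-integrable functions on the circle *)

Section SquareIntegrable.
Context {R : realType}.
Local Notation C := R[i].
Local Notation mu := (circle R).
Implicit Types (f g h : R -> C) (c : C).

Lemma ae_filter : Filter (almost_everywhere mu).
Proof. exact: ae_filter_ringOfSetsType. Qed.

Lemma ae_imp (P Q : R -> Prop) : (forall t, P t -> Q t) ->
  {ae mu, forall t, P t} -> {ae mu, forall t, Q t}.
Proof. by move=> PQ; apply: (@filterS _ _ ae_filter) => t; exact: PQ. Qed.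

Lemma ae_imp2 (P Q S : R -> Prop) : (forall t, P t -> Q t -> S t) ->
  {ae mu, forall t, P t} -> {ae mu, forall t, Q t} -> {ae mu, forall t, S t}.
Proof. by move=> PQS; apply: (@filterS2 _ _ ae_filter) => t; exact: PQS. Qed.

Definition cintegrable f : Prop :=
  mu.-integrable setT (EFin \o (fun t => Re (f t))) /\
  mu.-integrable setT (EFin \o (fun t => Im (f t))).

Definition sqnorm f : R := \int[mu]_t (normc (f t) ^+ 2).

Lemma cmeasurable_lin c f g : cmeasurable f -> cmeasurable g ->
  cmeasurable (fun t => c * f t + g t).
Proof.
move=> [fr fi] [gr gi]; split.
- rewrite (_ : (fun _ => _) = fun t => Re c * Re (f t) - Im c * Im (f t) + Re (g t)).
    apply: measurable_funD => //; apply: measurable_funB;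
    exact: measurable_funM.
  by apply/funext => t; rewrite !ReImE.
- rewrite (_ : (fun _ => _) = fun t => Re c * Im (f t) + Im c * Re (f t) + Im (g t)).
    apply: measurable_funD => //; apply: measurable_funD;
    exact: measurable_funM.
  by apply/funext => t; rewrite !ReImE.
Qed.

Lemma cmeasurable_mul f g : cmeasurable f -> cmeasurable g ->
  cmeasurable (fun t => f t * g t).
Proof.
move=> [fr fi] [gr gi]; split.
- rewrite (_ : (fun _ => _) = fun t => Re (f t) * Re (g t) - Im (f t) * Im (g t)).
    by apply: measurable_funB; exact: measurable_funM.
  by apply/funext => t; rewrite !ReImE.
- rewrite (_ : (fun _ => _) = fun t => Re (f t) * Im (g t) + Im (f t) * Re (g t)).
    by apply: measurable_funD; exact: measurable_funM.
  by apply/funext => t; rewrite !ReImE.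
Qed.

Lemma cmeasurable_conj f : cmeasurable f -> cmeasurable (fun t => conjc (f t)).
Proof.
move=> [fr fi]; split.
- by rewrite (_ : (fun _ => _) = fun t => Re (f t)) //; apply/funext => t;
    rewrite ReImE.
- rewrite (_ : (fun _ => _) = fun t => - Im (f t)); last first.
    by apply/funext => t; rewrite ReImE.
  exact: measurableT_comp.
Qed.

Lemma cmeasurable_cst c : cmeasurable (fun=> c).
Proof. by split; exact: measurable_cst. Qed.

Lemma cmeasurable_sqr f : cmeasurable f ->
  measurable_fun setT (fun t => normc (f t) ^+ 2).
Proof.
move=> [fr fi].
rewrite (_ : (fun _ => _) = fun t => Re (f t) ^+ 2 + Im (f t) ^+ 2).
  by apply: measurable_funD; exact: measurable_funX.
by apply/funext => t; rewrite normc_sqrE.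
Qed.

Lemma L2norm_poweR f :
  (L2norm f = (\int[mu]_t (normc (f t) ^+ 2)%:E) `^ (2^-1))%E.
Proof.
rewrite /L2norm unlock; congr (_ `^ _)%E.
apply: eq_integral => t _ /=.
by rewrite ger0_norm ?normc_ge0 // powR_mulrn // normc_ge0.
Qed.

Let integral_sq_ge0 f : (0 <= \int[mu]_t (normc (f t) ^+ 2)%:E)%E.
Proof. by apply: integral_ge0 => t _; rewrite lee_fin sqr_ge0. Qed.

Lemma sqnorm_ge0 f : 0 <= sqnorm f.
Proof. by apply: Rintegral_ge0 => t _; exact: sqr_ge0. Qed.

Lemma L2P f : L2 f <-> cmeasurable f /\
  mu.-integrable setT (EFin \o (fun t => normc (f t) ^+ 2)).
Proof.
split=> -[mf foo]; split => //.
- apply/integrableP; split.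
    by apply/measurable_EFinP; exact: cmeasurable_sqr.
  under eq_integral do rewrite /= ger0_norm ?sqr_ge0 //.
  move: foo; rewrite L2norm_poweR.
  case: (\int[mu]_t _)%E (integral_sq_ge0 f) => [r _ _||//]; first exact: ltry.
  by move=> _; rewrite poweRyr ?invr_eq0 ?pnatr_eq0.
- rewrite L2norm_poweR; apply: poweR_lty.
  move/integrableP : foo => [_].
  by under eq_integral do rewrite /= ger0_norm ?sqr_ge0 //.
Qed.

Lemma L2_sqnormE f : L2 f -> (\int[mu]_t (normc (f t) ^+ 2)%:E = (sqnorm f)%:E)%E.
Proof.
move=> /L2P[_ fi]; rewrite /sqnorm /Rintegral fineK //.
exact: integrable_fin_num.
Qed.

Lemma L2normE f : L2 f -> L2norm f = (Num.sqrt (sqnorm f))%:E.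
Proof.
by move=> Lf; rewrite L2norm_poweR L2_sqnormE // poweR_EFin powR12_sqrt ?sqnorm_ge0.
Qed.

Lemma integrable_domin (u v : R -> R) : measurable_fun setT u ->
  (forall t, `|u t| <= v t) -> mu.-integrable setT (EFin \o v) ->
  mu.-integrable setT (EFin \o u).
Proof.
move=> mfu uv; apply: le_integrable => //.
  exact/measurable_EFinP.
move=> t _ /=; rewrite lee_fin; apply: le_trans (uv t) _; exact: ler_norm.
Qed.

Lemma L2_domin f (v : R -> R) : cmeasurable f ->
  (forall t, normc (f t) ^+ 2 <= v t) -> mu.-integrable setT (EFin \o v) ->
  L2 f.
Proof.
move=> mf fv iv; apply/L2P; split => //.
apply: integrable_domin iv; first exact: cmeasurable_sqr.
by move=> t; rewrite ger0_norm ?sqr_ge0.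
Qed.

Lemma integrable_cst (r : R) : mu.-integrable setT (EFin \o (fun=> r)).
Proof. exact: finite_measure_integrable_cst. Qed.

Lemma L2_bounded f (B : R) : cmeasurable f -> (forall t, normc (f t) <= B) -> L2 f.
Proof.
move=> mf fB; apply: (@L2_domin _ (fun=> B ^+ 2)) => //; last exact: integrable_cst.
by move=> t; rewrite lerXn2r ?nnegrE ?normc_ge0 // (le_trans _ (fB t)) ?normc_ge0.
Qed.

Lemma L2_cst c : L2 (fun=> c).
Proof. by apply: (@L2_bounded _ (normc c)); [exact: cmeasurable_cst|]. Qed.

Lemma integrable_lin (a b : R) (u v : R -> R) :
  mu.-integrable setT (EFin \o u) -> mu.-integrable setT (EFin \o v) ->
  mu.-integrable setT (EFin \o (fun t => a * u t + b * v t)).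
Proof.
move=> iu iv.
rewrite (_ : EFin \o _ =
  (fun t => a%:E * (EFin \o u) t) \+ (fun t => b%:E * (EFin \o v) t))%E //.
by apply: integrableD => //; exact: integrableZl.
Qed.

Lemma L2_lin c f g : L2 f -> L2 g -> L2 (fun t => c * f t + g t).
Proof.
move=> /L2P[mf fi] /L2P[mg gi].
apply: (L2_domin (cmeasurable_lin c mf mg)
  (v := fun t => (2 * normc c ^+ 2) * normc (f t) ^+ 2 + 2 * normc (g t) ^+ 2)).
  move=> t; rewrite -mulrA -[_ * normc (f t) ^+ 2]exprMn -ComplexField.Normc.normcM.
  move: (c * f t) => z; rewrite !normc_sqrE !ReImE.
  have := sqr_ge0 (Re z - Re (g t)); have := sqr_ge0 (Im z - Im (g t)).
  by rewrite !sqrrB !sqrrD; lra.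
exact: integrable_lin.
Qed.

Lemma L2_conj f : L2 f -> L2 (fun t => conjc (f t)).
Proof.
move=> /L2P[mf fi]; apply: (L2_domin (cmeasurable_conj mf) _ fi) => t.
by rewrite normc_conj.
Qed.

Lemma L2_ae f g : {ae mu, forall t, f t = g t} -> L2 f -> cmeasurable g -> L2 g.
Proof.
move=> fg /L2P[mf fi] mg; apply/L2P; split => //.
have mfs := cmeasurable_sqr mf; have mgs := cmeasurable_sqr mg.
apply/integrableP; split; first exact/measurable_EFinP.
move/integrableP : fi => [_]; congr (_ < _)%E; apply: ae_eq_integral => //.
- by apply: measurableT_comp => //; exact/measurable_EFinP.
- by apply: measurableT_comp => //; exact/measurable_EFinP.
- by apply: (ae_imp _ fg) => t /= ->.
Qed.

Lemma sqnorm_ae f g : {ae mu, forall t, f t = g t} ->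
  cmeasurable f -> cmeasurable g -> sqnorm f = sqnorm g.
Proof.
move=> fg mf mg; rewrite /sqnorm /Rintegral; congr fine.
apply: ae_eq_integral => //.
- by apply/measurable_EFinP; exact: cmeasurable_sqr.
- by apply/measurable_EFinP; exact: cmeasurable_sqr.
- by apply: (ae_imp _ fg) => t /= ->.
Qed.

(** The multiplier is cut off to 0 where it exceeds its essential bound; this
    changes the product on a null set only. *)
Lemma L2_mul (B : R) f g : {ae mu, forall t, normc (g t) <= B} ->
  cmeasurable g -> L2 f -> L2 (fun t => g t * f t).
Proof.
move=> gB mg /L2P[mf fi].
pose g' t := if normc (g t) ^+ 2 <= B ^+ 2 then g t else 0.
have mle : measurable_fun setT (fun t => normc (g t) ^+ 2 <= B ^+ 2).
  by apply: measurable_fun_ler; [exact: cmeasurable_sqr | exact: measurable_cst].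
have mg' : cmeasurable g'.
  case: mg => mr mi; split.
  - rewrite (_ : (fun _ => _) =
      fun t => if normc (g t) ^+ 2 <= B ^+ 2 then Re (g t) else 0).
      by apply: measurable_fun_ifT => //; exact: measurable_cst.
    by apply/funext => t; rewrite /g'; case: ifP.
  - rewrite (_ : (fun _ => _) =
      fun t => if normc (g t) ^+ 2 <= B ^+ 2 then Im (g t) else 0).
      by apply: measurable_fun_ifT => //; exact: measurable_cst.
    by apply/funext => t; rewrite /g'; case: ifP.
apply: (@L2_ae (fun t => g' t * f t)).
- apply: (ae_imp _ gB) => t gt; rewrite /g' lerXn2r // ?nnegrE ?normc_ge0 //.
  exact: le_trans (normc_ge0 _) gt.
- apply: (@L2_domin _ (fun t => B ^+ 2 * normc (f t) ^+ 2 + 0 * normc (f t) ^+ 2)).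
  + exact: cmeasurable_mul.
  + move=> t; rewrite ComplexField.Normc.normcM exprMn mul0r addr0.
    rewrite ler_wpM2r ?sqr_ge0 // /g'; case: ifPn => // _.
    by rewrite normc_sqrE /= expr0n addr0 sqr_ge0.
  + exact: integrable_lin.
- exact: cmeasurable_mul.
Qed.

Lemma L2_inner_integrable f g : L2 f -> L2 g ->
  cintegrable (fun t => f t * conjc (g t)).
Proof.
move=> /L2P[mf fi] /L2P[mg gi].
have [mr mi] := cmeasurable_mul mf (cmeasurable_conj mg).
have iv := integrable_lin 1 1 fi gi.
split; apply: (integrable_domin _ _ iv) => // t.
- rewrite !ReImE mulrN opprK ler_norml !mul1r !normc_sqrE.
  have := sqr_ge0 (Re (f t) - Re (g t)); have := sqr_ge0 (Im (f t) - Im (g t)).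
  have := sqr_ge0 (Re (f t) + Re (g t)); have := sqr_ge0 (Im (f t) + Im (g t)).
  have := sqr_ge0 (Re (f t)); have := sqr_ge0 (Im (f t)).
  have := sqr_ge0 (Re (g t)); have := sqr_ge0 (Im (g t)).
  by rewrite !sqrrB !sqrrD => *; apply/andP; split; lra.
- rewrite !ReImE mulrN ler_norml !mul1r !normc_sqrE.
  have := sqr_ge0 (Re (f t) - Im (g t)); have := sqr_ge0 (Im (f t) - Re (g t)).
  have := sqr_ge0 (Re (f t) + Im (g t)); have := sqr_ge0 (Im (f t) + Re (g t)).
  have := sqr_ge0 (Re (f t)); have := sqr_ge0 (Im (f t)).
  have := sqr_ge0 (Re (g t)); have := sqr_ge0 (Im (g t)).
  by rewrite !sqrrB !sqrrD => *; apply/andP; split; lra.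
Qed.

Lemma Rintegral_lin (a b : R) (u v : R -> R) :
  mu.-integrable setT (EFin \o u) -> mu.-integrable setT (EFin \o v) ->
  \int[mu]_t (a * u t + b * v t) = a * \int[mu]_t u t + b * \int[mu]_t v t.
Proof.
move=> iu iv.
rewrite -!RintegralZl // -RintegralD //.
- exact: (@integrableZl _ _ _ mu setT measurableT a (EFin \o u)).
- exact: (@integrableZl _ _ _ mu setT measurableT b (EFin \o v)).
Qed.

Lemma cintegral_lin c f g : cintegrable f -> cintegrable g ->
  cintegral (fun t => c * f t + g t) = c * cintegral f + cintegral g.
Proof.
move=> [fr fi] [gr gi]; apply: complex_ext; rewrite ?ReImE /=.
- rewrite (_ : (fun _ => _) = fun t =>
    1 * (Re c * Re (f t) + - Im c * Im (f t)) + 1 * Re (g t)); last first.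
    by apply/funext => t; rewrite !ReImE; ring.
  rewrite !Rintegral_lin //; first by ring.
  exact: integrable_lin.
- rewrite (_ : (fun _ => _) = fun t =>
    1 * (Re c * Im (f t) + Im c * Re (f t)) + 1 * Im (g t)); last first.
    by apply/funext => t; rewrite !ReImE; ring.
  rewrite !Rintegral_lin //; first by ring.
  exact: integrable_lin.
Qed.

Lemma cintegral_conj f : cintegrable f ->
  cintegral (fun t => conjc (f t)) = conjc (cintegral f).
Proof.
move=> [fr fi]; apply: complex_ext; rewrite ?ReImE /=.
- by apply: eq_Rintegral => t _; rewrite ReImE.
- rewrite -mulN1r -RintegralZl //; apply: eq_Rintegral => t _.
  by rewrite ReImE mulN1r.
Qed.

Lemma cintegral_ae f g : {ae mu, forall t, f t = g t} ->
  cmeasurable f -> cmeasurable g -> cintegral f = cintegral g.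
Proof.
move=> fg [fr fi] [gr gi]; apply: complex_ext => /=;
  rewrite /Rintegral; congr fine; apply: ae_eq_integral => //;
  (try exact/measurable_EFinP); by apply: (ae_imp _ fg) => t /= ->.
Qed.

Lemma L2inner_sqnorm f : L2inner f f = (sqnorm f)%:C.
Proof.
rewrite /L2inner; apply: complex_ext => /=.
- by apply: eq_Rintegral => t _; rewrite mulr_conjc.
- rewrite -[RHS](_ : \int[mu]_t (0 : R) = 0); last by rewrite Rintegral_cst // mul0r.
  by apply: eq_Rintegral => t _; rewrite mulr_conjc.
Qed.

(** The regular module [C^o] carries the scaling of functions by constants. *)
Lemma L2_prehilbert :
  @prehilbert R (R -> C^o) (@L2 R) (@L2inner R).
Proof.
split.
- move=> c f g Lf Lg; exact: L2_lin.
- move=> c f g h Lf Lg Lh; rewrite /L2inner -cintegral_lin;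
    try exact: L2_inner_integrable.
  congr cintegral; apply/funext => t; rewrite mulrA -mulrDl //.
- move=> f g Lf Lg; rewrite /L2inner -cintegral_conj; last exact: L2_inner_integrable.
  by congr cintegral; apply/funext => t; rewrite rmorphM /= conjcK mulrC.
- by move=> f Lf; rewrite L2inner_sqnorm ler0c sqnorm_ge0.
Qed.

Lemma sqn_L2 f : sqn (@L2inner R : (R -> C^o) -> _ -> _) f = sqnorm f.
Proof. by rewrite /sqn L2inner_sqnorm. Qed.

End SquareIntegrable.
(** * Completeness of L2 *)

Section RapidlyCauchy.
Local Open Scope ereal_scope.
Context d {T : measurableType d} {R : realType}.
Variable mu : {measure set T -> \bar R}.

(** The total variation of the sequence at a point is integrable, hence finite
    almost everywhere, and there the telescoping series converges.  The limit is
    taken as an upper limit so that it is measurable everywhere. *)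
Lemma rapidly_cauchy_ae_cvg (w : nat -> T -> R) (B : R) :
  (forall j, measurable_fun setT (w j)) ->
  (forall n, \sum_(0 <= j < n) \int[mu]_t `|w j.+1 t - w j t|%:E <= B%:E) ->
  exists2 v : T -> R, measurable_fun setT v &
    {ae mu, forall t, (w j t @[j --> \oo] --> v t)%R}.
Proof.
move=> mw wB.
pose D j t := `|w j.+1 t - w j t|%:E.
have mD j : measurable_fun setT (D j).
  apply/measurable_EFinP; apply: measurableT_comp => //.
  exact: measurable_funB.
have D0 j t : 0 <= D j t by rewrite lee_fin.
pose S t := \sum_(j <oo) D j t.
have iS : mu.-integrable setT S.
  apply/integrableP; split.
    apply: (emeasurable_fun_cvg (fun n t => \sum_(0 <= j < n) D j t)).
      by move=> m; apply: emeasurable_sum.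
    by move=> t _; apply: is_cvg_nneseries.
  under eq_integral do rewrite gee0_abs ?nneseries_ge0 //.
  rewrite integral_nneseries //.
  apply: (@le_lt_trans _ _ B%:E); last exact: ltry.
  apply: lime_le; last by apply: nearW => n; exact: wB.
  by apply: is_cvg_nneseries => n _ _; exact: integral_ge0.
exists (fun t => fine (limn_esup (fun j => (w j t)%:E))).
  apply: measurableT_comp => //; apply: measurable_fun_limn_esup => // n.
  exact/measurable_EFinP.
apply: (@filterS _ _ (ae_filter_ringOfSetsType mu)) (integrable_ae measurableT iS).
move=> t /(_ I) St.
have cw : cvgn (w ^~ t).
  have : cvgn (series (telescope (w ^~ t))).
    apply: normed_cvg.
    have cS : cvgn (fun n => \sum_(0 <= j < n) D j t).
      by apply: is_cvg_nneseries.
    have : (fun n => \sum_(0 <= j < n) D j t) @ \oo --> (fine (S t))%:E.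
      by rewrite fineK.
    move=> /fine_cvg; set g := fine \o _.
    rewrite (_ : g = [normed series (telescope (w ^~ t))]%R).
      by move=> ?; apply/cvg_ex; eexists; eassumption.
    by apply/funext => n; rewrite /g /= /D sumEFin.
  rewrite telescopeK => /cvg_ex[/= l wl].
  apply/cvg_ex; exists (l + w 0%N t)%R.
  rewrite (_ : w ^~ t = fun n => (w n t - w 0%N t + w 0%N t)%R).
    by apply: cvgD => //; exact: cvg_cst.
  by apply/funext => n; rewrite subrK.
have /cvg_ex[l wl] := cw.
suff -> : limn_esup (fun j => (w j t)%:E) = l%:E by [].
apply: (cvg_limn_einf_sup _).2.
by apply: cvg_EFin => //; exact: nearW.
Qed.

End RapidlyCauchy.

Section L2Complete.
Context {R : realType}.
Local Notation C := R[i].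
Local Notation mu := (circle R).

Lemma sqnorm_cvg_L2norm (T : Type) (F : set_system T) {FF : Filter F}
    (u : T -> R -> C) : (\forall k \near F, L2 (u k)) ->
  (L2norm (u k) @[k --> F] --> 0%E) <-> (sqnorm (u k) @[k --> F] --> 0).
Proof.
move=> Lu; split.
- move=> /fine_cvg u0.
  have : fine (L2norm (u k)) * fine (L2norm (u k)) @[k --> F] --> 0.
    by rewrite -[X in _ --> X](mulr0 0); exact: cvgM.
  apply: cvg_trans; apply: near_eq_cvg.
  apply: filterS Lu => k Lk.
  by rewrite (L2normE Lk) /= -expr2 sqr_sqrtr // sqnorm_ge0.
- move=> u0.
  have : (Num.sqrt (sqnorm (u k)))%:E @[k --> F] --> 0%E.
    apply: cvg_EFin; first exact: nearW.
    rewrite -(sqrtr0 R).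
    exact: cvg_comp u0 (@sqrt_continuous R 0).
  apply: cvg_trans; apply: near_eq_cvg.
  by apply: filterS Lu => k Lk; rewrite (L2normE Lk).
Qed.

(** Arithmetic-geometric mean between [|p|] and the constant 1, with a free
    weight [a]: weights growing along the sequence make L2-increments summable
    in L1. *)
Lemma integral_le_sqnorm (a : R) (p : R -> R) (f : R -> C) : 0 < a ->
  measurable_fun setT p -> (forall t, p t ^+ 2 <= normc (f t) ^+ 2) -> L2 f ->
  (\int[mu]_t `|p t|%:E <= ((a * sqnorm f + a^-1) / 2)%:E)%E.
Proof.
move=> a0 mp pf /L2P[mf fi].
have i2 := integrable_lin (a / 2) (a^-1 / 2) fi (integrable_cst 1).
have -> : ((a * sqnorm f + a^-1) / 2)%:E =
    (\int[mu]_t (a / 2 * normc (f t) ^+ 2 + a^-1 / 2 * 1)%:E)%E.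
  rewrite -[RHS]fineK; last exact: integrable_fin_num i2.
  congr (_%:E); rewrite -[RHS]/(\int[mu]_t _) Rintegral_lin //; last exact: integrable_cst.
  rewrite Rintegral_cst //.
  transitivity (a / 2 * sqnorm f + a^-1 / 2 * (1 * 1)); first by ring.
  congr (_ + _ * (_ * _)).
  exact: (congr1 fine (esym (probability_setT (circle R)))).
apply: ge0_le_integral => //.
- by apply/measurable_EFinP; exact: measurableT_comp.
- exact: (measurable_int mu).
- move=> t _; rewrite lee_fin.
  apply: (@le_trans _ _ (a / 2 * `|p t| ^+ 2 + a^-1 / 2 * 1)).
    rewrite -subr_ge0.
    have -> : a / 2 * `|p t| ^+ 2 + a^-1 / 2 * 1 - `|p t|
        = a^-1 / 2 * (a * `|p t| - 1) ^+ 2 by field; rewrite gt_eqF.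
    by rewrite mulr_ge0 ?sqr_ge0 // divr_ge0 // invr_ge0 ltW.
  rewrite lerD2r ler_wpM2l // ?divr_ge0 ?(ltW a0) //.
  by rewrite -normrX ger0_norm ?sqr_ge0.
Qed.

Lemma measurable_fun_limn_einf (h : nat -> R -> \bar R) :
  (forall n, measurable_fun setT (h n : measurableTypeR R -> _)) ->
  measurable_fun setT ((fun t => limn_einf (h ^~ t)) : measurableTypeR R -> _).
Proof.
move=> mh; rewrite (_ : (fun _ => _) =
    fun t => (- limn_esup ((fun n t => - h n t) ^~ t))%E).
  apply: measurableT_comp => //.
  by apply: measurable_fun_limn_esup => // n; exact: measurableT_comp.
by apply/funext => t; rewrite -limn_einfN; congr limn_einf; apply/funext => n;
  rewrite /= oppeK.
Qed.

Lemma sqnorm_fatou (v : nat -> R -> C) (g f : R -> C) (B : R) :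
  (forall j, L2 (v j)) -> L2 g -> cmeasurable f ->
  {ae mu, forall t, Re (v j t) @[j --> \oo] --> Re (f t)} ->
  {ae mu, forall t, Im (v j t) @[j --> \oo] --> Im (f t)} ->
  (\forall j \near \oo, sqnorm (fun t => g t - v j t) <= B) ->
  (\int[mu]_t (normc (g t - f t) ^+ 2)%:E <= B%:E)%E.
Proof.
move=> Lv Lg mf vr vi vB.
have Lgv j : L2 (fun t => g t - v j t) by exact: (ph_sub L2_prehilbert).
pose h j t := (normc (g t - v j t) ^+ 2)%:E.
have mh j : measurable_fun setT (h j : measurableTypeR R -> _).
  by apply/measurable_EFinP; apply: cmeasurable_sqr; have /L2P[] := Lgv j.
have mgf : cmeasurable (fun t => g t - f t).
  rewrite (_ : (fun _ => _) = fun t => -1 * f t + g t); last first.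
    by apply/funext => t; rewrite mulN1r addrC.
  by apply: cmeasurable_lin => //; have /L2P[] := Lg.
have -> : (\int[mu]_t (normc (g t - f t) ^+ 2)%:E =
    \int[mu]_t limn_einf (h ^~ t))%E.
  apply: ae_eq_integral => //.
  - by apply/measurable_EFinP; exact: cmeasurable_sqr.
  - exact: measurable_fun_limn_einf.
  - apply: (ae_imp2 _ vr vi) => t vrt vit _.
    apply/esym/(cvg_limn_einf_sup _).1; apply: cvg_EFin; first exact: nearW.
    rewrite /h /comp /=.
    rewrite (_ : (fun _ => _) = fun j => (Re (g t) - Re (v j t)) ^+ 2 +
      (Im (g t) - Im (v j t)) ^+ 2); last first.
      by apply/funext => j; rewrite normc_sqrE !ReImE.
    rewrite normc_sqrE !ReImE !expr2.
    apply: cvgD; apply: cvgM; apply: cvgB => //; exact: cvg_cst.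
apply: le_trans (fatou mu measurableT mh _) _.
  by move=> n t _; rewrite lee_fin sqr_ge0.
rewrite limn_einf_lim; apply: lime_le; first exact: is_cvg_einfs.
near=> n; apply: (@le_trans _ _ (\int[mu]_t h n t)%E).
  by apply: ereal_inf_lbound; exists n => /=.
by rewrite /h L2_sqnormE // lee_fin; near: n.
Unshelve. all: by end_near. Qed.

(** Riesz-Fischer. *)
Theorem L2_complete : sqn_complete (@L2 R : set (R -> C^o)) (@L2inner R).
Proof.
move=> u Lu cu.
have /choice[N NP] (j : nat) : exists N, forall k l, (N <= k)%N -> (N <= l)%N ->
    sqnorm (fun t => u k t - u l t) < 4^-1 ^+ j.
  have [|N NP] := cu (4^-1 ^+ j); first by rewrite exprn_gt0 // invr_gt0.
  by exists N => k l Nk Nl; rewrite -sqn_L2; exact: NP.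
pose n j := (\sum_(i < j.+1) N i)%N.
have nN i j : (i <= j)%N -> (N i <= n j)%N.
  by move=> ij; rewrite /n (bigD1 (Ordinal (ij : (i < j.+1)%N))) //= leq_addr.
pose v j := u (n j).
have Lv j : L2 (v j) by exact: Lu.
have Lvv j : L2 (fun t => v j.+1 t - v j t) by exact: (ph_sub L2_prehilbert).
have vv j : sqnorm (fun t => v j.+1 t - v j t) < 4^-1 ^+ j.
  by apply: NP; apply: nN.
have key (w : nat -> R -> R) : (forall j, measurable_fun setT (w j)) ->
    (forall j t, (w j.+1 t - w j t) ^+ 2 <= normc (v j.+1 t - v j t) ^+ 2) ->
    exists2 v : R -> R, measurable_fun setT v &
      {ae mu, forall t, (w j t @[j --> \oo] --> v t)%R}.
  move=> mw wv; apply: (@rapidly_cauchy_ae_cvg _ _ R mu w 2) => // m.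
  (* the weight 2^j balances increments of squared norm at most 4^-j *)
  have le j : (\int[mu]_t `|w j.+1 t - w j t|%:E <= (2^-1 ^+ j)%:E)%E.
    have a0 : 0 < 2 ^+ j :> R by rewrite exprn_gt0.
    apply: (le_trans (integral_le_sqnorm a0 _ (wv j) (Lvv j))).
      exact: measurable_funB.
    rewrite lee_fin.
    have -> : 2^-1 ^+ j = (2 ^+ j * 4^-1 ^+ j + (2 ^+ j)^-1) / 2 :> R.
      rewrite -exprMn exprVn.
      have -> : 2 * 4^-1 = 2^-1 :> R by field.
      by rewrite exprVn; field; rewrite expf_neq0.
    by rewrite ler_pM2r ?invr_gt0 // lerD2r ler_pM2l // ltW.
  apply: (@le_trans _ _ (\sum_(0 <= j < m) (2^-1 ^+ j)%:E)%E).
    by apply: lee_sum => j _; exact: le.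
  rewrite sumEFin lee_fin.
  have -> : \sum_(0 <= j < m) 2^-1 ^+ j = 2 - 2 * 2^-1 ^+ m :> R.
    elim: m => [|m IH]; first by rewrite big_nil expr0; ring.
    by rewrite big_nat_recr //= IH exprS; field.
  by rewrite lerBlDr lerDl mulr_ge0 // exprn_ge0 // invr_ge0.
have [fr mfr vfr] : exists2 w : R -> R, measurable_fun setT w &
    {ae mu, forall t, (Re (v j t) @[j --> \oo] --> w t)%R}.
  apply: key => [j|j t]; first by have /L2P[[]] := Lv j.
  by rewrite normc_sqrE !ReImE lerDl sqr_ge0.
have [fi mfi vfi] : exists2 w : R -> R, measurable_fun setT w &
    {ae mu, forall t, (Im (v j t) @[j --> \oo] --> w t)%R}.
  apply: key => [j|j t]; first by have /L2P[[]] := Lv j.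
  by rewrite normc_sqrE !ReImE lerDr sqr_ge0.
pose f t := fr t +i* fi t.
have mf : cmeasurable f by [].
have uf m k : (N m <= k)%N ->
    (\int[mu]_t (normc (u k t - f t) ^+ 2)%:E <= (4^-1 ^+ m)%:E)%E.
  move=> mk; apply: (@sqnorm_fatou v) => //.
  by exists m => // j mj; apply/ltW/NP => //; exact: nN.
have Luf m k : (N m <= k)%N -> L2 (fun t => u k t - f t).
  move=> mk; apply/L2P; split.
    rewrite (_ : (fun _ => _) = fun t => -1 * f t + u k t); last first.
      by apply/funext => t; rewrite mulN1r addrC.
    by apply: cmeasurable_lin => //; have /L2P[] := Lu k.
  apply/integrableP; split.
    apply/measurable_EFinP; apply: cmeasurable_sqr.
    rewrite (_ : (fun _ => _) = fun t => -1 * f t + u k t); last first.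
      by apply/funext => t; rewrite mulN1r addrC.
    by apply: cmeasurable_lin => //; have /L2P[] := Lu k.
  under eq_integral do rewrite /= ger0_norm ?sqr_ge0 //.
  by apply: le_lt_trans (uf _ _ mk) _; exact: ltry.
have Lf : L2 f.
  rewrite (_ : f = fun t => u (N 0) t - (u (N 0) t - f t)).
    by apply: (ph_sub L2_prehilbert) => //; exact: Luf (leqnn _).
  by apply/funext => t; rewrite opprB addrC subrK.
exists f => //.
apply/cvgrPdist_le => e e0.
have g0 : (4^-1 ^+ m : R) @[m --> \oo] --> 0.
  by apply: cvg_expr; rewrite ger0_norm ?invr_ge0 // invf_lt1 // ltr1n.
have [m _ /(_ m (leqnn m)) /= me] := (@cvgr_le _ _ _ _ _ _ g0 e e0).
exists (N m) => // k /= mk.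
rewrite sub0r normrN sqn_L2 ger0_norm ?sqnorm_ge0 //; apply: le_trans me.
rewrite -lee_fin -L2_sqnormE; first exact: uf.
exact: Luf mk.
Qed.

End L2Complete.
(** * Square-integrable vector functions *)

Section VectorL2.
Context {R : realType} {n : nat}.
Local Notation C := R[i].
Local Notation vfun := (R -> 'cV[C]_n).
Implicit Types (X Y : vfun) (c : C).

Lemma coord_lin c X Y i :
  coord (fun t => c *: X t + Y t) i = fun t => c * coord X i t + coord Y i t.
Proof. by apply/funext => t; rewrite /coord !mxE. Qed.

Lemma coord_sub X Y i :
  coord (fun t => X t - Y t) i = fun t => coord X i t - coord Y i t.
Proof. by apply/funext => t; rewrite /coord !mxE. Qed.

Lemma vinner_prehilbert :
  @prehilbert R (R -> 'cV[C]_n) (vec_of (@L2 R)) (@vinner R n).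
Proof.
have H := @L2_prehilbert R; split.
- move=> c X Y LX LY i; rewrite coord_lin; exact: L2_lin.
- move=> c X Y Z LX LY LZ; rewrite /vinner mulr_sumr -big_split.
  apply: eq_bigr => i _; rewrite coord_lin; exact: (ip_lin H).
- move=> X Y LX LY; rewrite /vinner rmorph_sum.
  by apply: eq_bigr => i _; rewrite (ip_conj H).
- by move=> X LX; apply: sumr_ge0 => i _; exact: (ip_ge0 H).
Qed.

Lemma sqn_vinner X : sqn (@vinner R n) X = \sum_(i < n) sqnorm (coord X i).
Proof.
rewrite /sqn /vinner.
rewrite (eq_bigr (fun i => (sqnorm (coord X i))%:C)) => [|i _]; last first.
  exact: L2inner_sqnorm.
by rewrite -(rmorph_sum (real_complex R)).
Qed.

Lemma sqnorm_coord_le X i : sqnorm (coord X i) <= sqn (@vinner R n) X.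
Proof.
rewrite sqn_vinner (bigD1 i) //= lerDl; apply: sumr_ge0 => j _.
exact: sqnorm_ge0.
Qed.

Lemma vcvg_sqn (u : nat -> vfun) X :
  (forall k, vec_of (@L2 R) (u k)) -> vec_of (@L2 R) X ->
  vcvg u X <-> sqn (@vinner R n) (u k - X) @[k --> \oo] --> 0.
Proof.
move=> Lu LX.
have Ld i : \forall k \near \oo, L2 (fun t => coord (u k) i t - coord X i t).
  apply: nearW => k; apply: (ph_sub L2_prehilbert); [exact: Lu | exact: LX].
have coordE k i : coord (u k - X) i = fun t => coord (u k) i t - coord X i t.
  exact: coord_sub.
split=> [uX|uX i].
- have -> : (fun k => sqn (@vinner R n) (u k - X)) =
      fun k => \sum_(i < n) sqnorm (fun t => coord (u k) i t - coord X i t).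
    apply/funext => k; rewrite sqn_vinner.
    by apply: eq_bigr => i _; rewrite coordE.
  elim: (index_enum _) => [|i r IH].
    by under eq_fun do rewrite big_nil; exact: cvg_cst.
  under eq_fun do rewrite big_cons.
  have h := cvgD ((sqnorm_cvg_L2norm (Ld i)).1 (uX i)) IH.
  by rewrite addr0 in h; exact: h.
- apply: (sqnorm_cvg_L2norm (Ld i)).2.
  apply: (@squeeze_cvgr _ _ _ _ (fun=> 0)
    (fun k => sqn (@vinner R n) (u k - X))) => //; last exact: cvg_cst.
  near=> k; rewrite sqnorm_ge0 -coordE; exact: sqnorm_coord_le.
Unshelve. all: by end_near. Qed.

Lemma vec_L2_complete : sqn_complete (vec_of (@L2 R)) (@vinner R n).
Proof.
move=> u Lu cu.
have /choice[x xP] (i : 'I_n) : exists x : R -> C,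
    L2 x /\ sqnorm (fun t => coord (u k) i t - x t) @[k --> \oo] --> 0.
  have [||x Lx ux] := @L2_complete R (fun k => coord (u k) i).
  - by move=> k; exact: Lu.
  - move=> e e0; have [N NP] := cu e e0; exists N => k l Nk Nl.
    apply: le_lt_trans (NP k l Nk Nl); rewrite sqn_L2.
    have := sqnorm_coord_le (u k - u l) i; rewrite (coord_sub (u k) (u l)).
    exact.
  - by exists x; split=> //; move: ux; under eq_cvg do rewrite sqn_L2.
pose X : vfun := fun t => \col_i x i t.
have XE i : coord X i = x i by apply/funext => t; rewrite /coord mxE.
have LX : vec_of (@L2 R) X by move=> i; rewrite XE; case: (xP i).
exists X => //; apply/vcvg_sqn => // i; apply: (sqnorm_cvg_L2norm _).2.
  apply: nearW => k; apply: (ph_sub L2_prehilbert); [exact: Lu | exact: LX].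
by rewrite XE; case: (xP i).
Qed.

Theorem vec_L2_projection (V : set vfun) :
  V `<=` vec_of (@L2 R) -> V !=set0 ->
  (forall c X Y, V X -> V Y -> V (fun t => c *: X t + Y t)) ->
  (forall (u : nat -> vfun) X, (forall k, V (u k)) -> vec_of (@L2 R) X ->
     vcvg u X -> V X) ->
  forall X, vec_of (@L2 R) X ->
  exists2 P, V P & forall Y, V Y -> vinner (fun t => X t - P t) Y = 0.
Proof.
move=> VL V0 Vlin Vcl X LX.
apply: (hilbert_projection vinner_prehilbert VL V0 Vlin vec_L2_complete _ LX).
move=> u Y Vu LY uY; apply: (Vcl u) => //; apply/vcvg_sqn => // k.
exact: VL.
Qed.

End VectorL2.
(** * Trigonometric polynomials *)

Section Exponentials.
Context {R : realType}.
Local Notation C := R[i].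
Local Notation mu := (circle R).
Implicit Types (f g : R -> C) (p q : {poly C}).

Definition circle_poly p : R -> C := fun t => p.[cexpi t].

Lemma cexpi_conj (t : R) : cexpi t * conjc (cexpi t) = 1.
Proof.
rewrite mulr_conjc normc_sqrE /= cos2Dsin2 //.
Qed.

Lemma normc_cexpi (t : R) : normc (cexpi t) = 1.
Proof. by rewrite /= cos2Dsin2 sqrtr1. Qed.

Lemma cexpiV (t : R) : (cexpi t)^-1 = conjc (cexpi t).
Proof.
have e0 : cexpi t != 0.
  apply/eqP => e0; have := normc_cexpi t; rewrite e0 ComplexField.Normc.normc0.
  by move/eqP; rewrite eq_sym oner_eq0.
by apply: (mulfI e0); rewrite mulfV // cexpi_conj.
Qed.

Lemma cexpiD (s t : R) : cexpi (s + t) = cexpi s * cexpi t.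
Proof.
by apply: complex_ext; rewrite !ReImE /= ?cosD ?sinD // addrC [cos s * _]mulrC.
Qed.

Lemma cexpiX (t : R) k : cexpi t ^+ k = cexpi (k%:R * t).
Proof.
elim: k => [|k IH]; last by rewrite exprS IH -cexpiD mulrS mulrDl mul1r.
by rewrite expr0 mul0r /cexpi cos0 sin0.
Qed.

Lemma cmeasurable_cexpi : cmeasurable (@cexpi R).
Proof.
by split; apply: continuous_measurable_fun;
  [exact: continuous_cos | exact: continuous_sin].
Qed.

Lemma L2_cexpi_mul f : L2 f -> L2 (fun t => cexpi t * f t).
Proof.
apply: (@L2_mul R 1); last exact: cmeasurable_cexpi.
by apply: aeW => t; rewrite normc_cexpi.
Qed.

Lemma L2_cexpi_conj_mul f : L2 f -> L2 (fun t => conjc (cexpi t) * f t).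
Proof.
apply: (@L2_mul R 1); last exact/cmeasurable_conj/cmeasurable_cexpi.
by apply: aeW => t; rewrite normc_conj normc_cexpi.
Qed.

Lemma circle_poly_MXaddC p c : circle_poly (p * 'X + c%:P) = fun t => cexpi t * circle_poly p t + c.
Proof. by apply/funext => t; rewrite /circle_poly !hornerE mulrC. Qed.

Lemma L2_circle_poly p : L2 (circle_poly p).
Proof.
elim/poly_ind: p => [|p c IH].
  rewrite (_ : circle_poly 0 = fun=> 0); first exact: L2_cst.
  by apply/funext => t; rewrite /circle_poly horner0.
rewrite circle_poly_MXaddC (_ : (fun _ => _) = fun t => 1 * (cexpi t * circle_poly p t) + c).
  by apply: L2_lin; [exact: L2_cexpi_mul | exact: L2_cst].
by apply/funext => t; rewrite mul1r.
Qed.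

(** Nonnegativity lets the uniform law be turned into a Lebesgue integral; it is
    harmless, since a constant may be added to a bounded function. *)
Lemma integral_circle_FTC (f F : R -> R) : continuous f -> (forall t, 0 <= f t) ->
  (forall t : R, is_derive t 1 F (f t)) ->
  \int[mu]_t f t = (2 * pi)^-1 * (F (2 * pi) - F 0).
Proof.
move=> cf f0 dF.
rewrite /Rintegral integral_uniform //; last first.
  by apply/measurable_EFinP; exact: continuous_measurable_fun.
rewrite subr0 (@continuous_FTC2 _ f F) ?twopi_gt0 //.
- exact: continuous_subspaceT.
- have cF t : F x @[x --> t] --> F t.
    by apply/differentiable_continuous/derivable1_diffP; exact: ex_derive.
  split.
  + by move=> t _; exact: ex_derive.
  + by apply: cvg_at_right_filter; exact: cF.
  + by apply: cvg_at_left_filter; exact: cF.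
- by move=> t _; rewrite derive1E; exact: derive_val.
Qed.

Lemma cintegral_cexpiX k : cintegral (fun t => cexpi t ^+ k.+1 : C) = 0.
Proof.
set n : R := k.+1%:R.
have n0 : n != 0 by rewrite pnatr_eq0.
have [c2 s2] : cos (n * (2 * pi)) = 1 /\ sin (n * (2 * pi)) = 0.
  have := cexpiX (2 * pi) k.+1; rewrite -/n /cexpi.
  rewrite mulrC mulr_natr cos2pi sin2pi -[1 +i* 0]/(1 : C) expr1n.
  by rewrite -mulr_natr [pi * _]mulrC => -[<- <-].
have pi2 : 2 * pi != 0 :> R by rewrite gt_eqF // twopi_gt0.
have L2e : L2 (fun t => cexpi t ^+ k.+1 : C).
  by have := L2_circle_poly 'X^(k.+1); congr L2; apply/funext => t; rewrite /circle_poly hornerXn.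
have [ir ii] := L2_inner_integrable L2e (L2_cst 1).
have reE : (fun t => Re (cexpi t ^+ k.+1 * conjc (1 : C))) = fun t => cos (n * t).
  by apply/funext => t; rewrite rmorph1 mulr1 cexpiX.
have imE : (fun t => Im (cexpi t ^+ k.+1 * conjc (1 : C))) = fun t => sin (n * t).
  by apply/funext => t; rewrite rmorph1 mulr1 cexpiX.
rewrite reE in ir; rewrite imE in ii.
have one : \int[mu]_t (1 : R) = 1.
  by rewrite Rintegral_cst // mul1r; exact: (congr1 fine (probability_setT (circle R))).
have split1 (u : R -> R) : mu.-integrable setT (EFin \o u) ->
    \int[mu]_t (1 + u t) = 1 -> \int[mu]_t u t = 0.
  move=> iu; rewrite RintegralD //; last exact: integrable_cst.
  by rewrite one => /(canRL (addKr _)) ->; rewrite addNr.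
apply: complex_ext => /=.
- under eq_Rintegral do rewrite cexpiX /=.
  apply: split1 => //.
  apply: etrans (@integral_circle_FTC _ (fun t => t + n^-1 * sin (n * t)) _ _ _) _.
  + move=> t; apply: cvgD; first exact: cvg_cst.
    apply: continuous_comp; last exact: continuous_cos.
    by apply: cvgM; [exact: cvg_cst | exact: cvg_id].
  + by move=> t; rewrite -lerBlDl sub0r cos_geN1.
  + move=> t; apply: is_derive_eq.
    by rewrite /GRing.scale /= ; field.
  + by rewrite s2 !mulr0 sin0 !mulr0 !addr0 subr0 mulVf.
- under eq_Rintegral do rewrite cexpiX /=.
  apply: split1 => //.
  apply: etrans (@integral_circle_FTC _ (fun t => t - n^-1 * cos (n * t)) _ _ _) _.
  + move=> t; apply: cvgD; first exact: cvg_cst.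
    apply: continuous_comp; last exact: continuous_sin.
    by apply: cvgM; [exact: cvg_cst | exact: cvg_id].
  + by move=> t; rewrite -lerBlDl sub0r sin_geN1.
  + move=> t; apply: is_derive_eq.
    by rewrite /GRing.scale /= ; field.
  + by rewrite c2 mulr0 cos0 sub0r opprK subrK mulVf.
Qed.

End Exponentials.
(** * Fourier coefficients *)

Section FourierCoefficients.
Context {R : realType}.
Local Notation C := R[i].
Local Notation mu := (circle R).
Implicit Types (f g : R -> C) (p q : {poly C}) (c : nat -> C).

Let H := @L2_prehilbert R.

Definition trig (k : nat) : R -> C := fun t => cexpi t ^+ k.

Lemma circle_polyXn k : circle_poly 'X^k = trig k.
Proof. by apply/funext => t; rewrite /circle_poly hornerXn. Qed.

Lemma L2_trig k : L2 (trig k).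
Proof. by rewrite -circle_polyXn; exact: L2_circle_poly. Qed.

Lemma cintegral_trig k : cintegral (trig k) = (k == 0%N)%:R.
Proof.
case: k => [|k]; last exact: cintegral_cexpiX.
have one : \int[mu]_t (1 : R) = 1.
  by rewrite Rintegral_cst // mul1r; exact: (congr1 fine (probability_setT (circle R))).
by apply: complex_ext => //=; rewrite Rintegral_cst // mul0r.
Qed.

Lemma trig_orthonormal j k : L2inner (trig j) (trig k) = (j == k)%:R.
Proof.
have key m d : L2inner (trig (d + m)) (trig m) = (d == 0%N)%:R.
  rewrite -cintegral_trig /L2inner; congr cintegral; apply/funext => t.
  by rewrite /trig rmorphXn exprD -mulrA -exprMn cexpi_conj expr1n mulr1.
have [jk|kj] := leqP k j.
  by rewrite -[in LHS](subnK jk) key subn_eq0 eqn_leq jk andbT.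
rewrite (ip_conj H (L2_trig k) (L2_trig j)) -[in LHS](subnK (ltnW kj)) key.
by rewrite subn_eq0 leqNgt kj ltn_eqF // rmorph_nat.
Qed.

Lemma inner_circle_poly_poly g c N : L2 g ->
  L2inner g (circle_poly (\poly_(k < N) c k)) =
  \sum_(k < N) conjc (c k) * L2inner g (trig k).
Proof.
move=> Lg; elim: N => [|N IH].
  rewrite poly_def !big_ord0 (_ : circle_poly 0 = fun t => trig 0 t - trig 0 t).
    by rewrite (ip_subr H (L2_trig 0) (L2_trig 0) Lg) subrr.
  by apply/funext => t; rewrite /circle_poly horner0 subrr.
rewrite poly_def !big_ord_recr /= -poly_def -IH.
rewrite (_ : circle_poly _ = fun t => c N * trig N t + circle_poly (\poly_(k < N) c k) t).
  by rewrite (ip_linr H _ (L2_trig N) (L2_circle_poly _) Lg) addrC.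
by apply/funext => t; rewrite -circle_polyXn /circle_poly hornerD hornerZ addrC.
Qed.

Lemma inner_circle_poly_trig p k : L2inner (circle_poly p) (trig k) = p`_k.
Proof.
have key N c : L2inner (circle_poly (\poly_(k < N) c k)) (trig k) =
    (\poly_(k < N) c k)`_k.
  rewrite (ip_conj H (L2_trig k) (L2_circle_poly _)) inner_circle_poly_poly; last exact: L2_trig.
  rewrite rmorph_sum coef_poly; case: ifPn => [kN|kN].
    rewrite (bigD1 (Ordinal kN)) //= trig_orthonormal eqxx mulr1 conjcK.
    rewrite big1 ?addr0 // => i ik; rewrite trig_orthonormal.
    rewrite (_ : (k == i) = false) ?mulr0 ?rmorph0 //.
    by apply: contraNF ik => /eqP ki; apply/eqP/val_inj.
  rewrite big1 ?rmorph0 // => i _; rewrite trig_orthonormal.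
  rewrite (_ : (k == i) = false) ?mulr0 ?rmorph0 //.
  by apply: contraNF kN => /eqP ->.
by rewrite -[p]coefK key.
Qed.

Lemma parseval_circle_poly p N : (size p <= N)%N ->
  sqnorm (circle_poly p) = \sum_(k < N) normc p`_k ^+ 2.
Proof.
move=> pN; have pE : p = \poly_(k < N) p`_k.
  apply/polyP => k; rewrite coef_poly; case: ltnP => // Nk.
  by rewrite nth_default // (leq_trans pN).
apply: complexI; rewrite -L2inner_sqnorm {2}pE inner_circle_poly_poly; last exact: L2_circle_poly.
rewrite (rmorph_sum (real_complex R)) /=; apply: eq_bigr => k _.
by rewrite inner_circle_poly_trig mulrC mulr_conjc.
Qed.

Lemma cintegral_inner1 f : cintegral f = L2inner f (fun=> 1).
Proof. by congr cintegral; apply/funext => t; rewrite rmorph1 mulr1. Qed.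

Lemma cintegral_circle_poly p : cintegral (circle_poly p) = p.[0].
Proof. by rewrite cintegral_inner1 horner_coef0 -(inner_circle_poly_trig p 0). Qed.

(** The partial sum of the analytic half of the Fourier series. *)
Definition fourier_poly f N : {poly C} := \poly_(k < N) L2inner f (trig k).

(** Pythagoras: the error of the Fourier sum is orthogonal to all polynomials of
    small degree, so the sum is their best approximation of [f]. *)
Lemma fourier_best f p N : L2 f -> (size p <= N)%N ->
  sqnorm (fun t => f t - circle_poly p t) =
  sqnorm (fun t => f t - circle_poly (fourier_poly f N) t)
  + sqnorm (circle_poly (fourier_poly f N - p)).
Proof.
move=> Lf pN; set s := fourier_poly f N.
have Lfs : L2 (fun t => f t - circle_poly s t) by exact: (ph_sub H Lf (L2_circle_poly s)).
have orth q : (size q <= N)%N -> L2inner (fun t => f t - circle_poly s t) (circle_poly q) = 0.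
  move=> qN; have -> : q = \poly_(k < N) q`_k.
    apply/polyP => k; rewrite coef_poly; case: ltnP => // Nk.
    by rewrite nth_default // (leq_trans qN).
  rewrite inner_circle_poly_poly // big1 // => k _.
  rewrite (ip_sub H Lf (L2_circle_poly s) (L2_trig k)) inner_circle_poly_trig coef_poly ltn_ord.
  by rewrite subrr mulr0.
have sN : (size (s - p)%R <= N)%N.
  rewrite (leq_trans (size_polyD _ _)) // size_polyN geq_max pN andbT.
  exact: size_poly.
rewrite -!sqn_L2 (_ : (fun t => f t - circle_poly p t) =
  (1 *: (fun t => f t - circle_poly s t) : R -> C^o) + circle_poly (s - p)); last first.
  apply/funext => t.
  rewrite -[RHS]/(1 * (f t - circle_poly s t) + circle_poly (s - p) t) /circle_poly hornerD hornerN.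
  by rewrite mul1r addrA subrK.
rewrite (sqnD H _ Lfs (L2_circle_poly _)) orth // normc_sqrE mulr0 /=.
by rewrite expr1n expr0n mulr0 !addr0 mul1r.
Qed.

Lemma bessel f N : L2 f ->
  \sum_(k < N) normc (L2inner f (trig k)) ^+ 2 <= sqnorm f.
Proof.
move=> Lf; have := fourier_best (p := 0) (N := N) Lf.
rewrite size_poly0 subr0 => /(_ (leq0n _)).
rewrite (parseval_circle_poly (size_poly _ _)).
rewrite (_ : (fun _ => _) = f); last first.
  by apply/funext => t; rewrite /circle_poly horner0 subr0.
move=> ->; rewrite (eq_bigr (fun k : 'I_N => normc (fourier_poly f N)`_k ^+ 2)).
  by rewrite lerDr sqnorm_ge0.
by move=> k _; rewrite coef_poly ltn_ord.
Qed.

End FourierCoefficients.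
(** * Boundary functions and the Hardy space *)

Section ComplexSeries.
Context {R : realType}.
Local Notation C := R[i].

(** Complex absolute values live in [C]; this trades them for real bounds. *)
Lemma ccvgP (u : nat -> C) (l : C) :
  (fun n => (u n : C^o)) @ \oo --> (l : C^o) <->
  forall e : R, 0 < e -> exists N, forall n, (N <= n)%N -> normc (u n - l) < e.
Proof.
split=> [/cvgrPdist_lt h e e0|h].
- have [|N _ NP] := h e%:C; first by rewrite (ltcR 0).
  exists N => n Nn; have := NP n Nn.
  by rewrite /= distrC normr_normc ltcR.
- apply/cvgrPdist_lt => e e0.
  have eE : e = (Re e)%:C.
    by move: e0; rewrite ltcE => /andP[/eqP i0 _]; apply: complex_ext.
  have [|N NP] := h (Re e); first by move: e0; rewrite eE (ltcR 0).
  exists N => // n Nn /=.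
  by have := NP n Nn; rewrite -ltcR -eE -normr_normc distrC.
Qed.

Lemma normc_le_add (z : C) : normc z <= `|Re z| + `|Im z|.
Proof.
rewrite -(@ler_pXn2r _ 2) ?nnegrE ?normc_ge0 ?addr_ge0 //.
rewrite normc_sqrE sqrrD !real_normK ?num_real // lerD2r lerDl.
by rewrite mulrn_wge0 // mulr_ge0.
Qed.

(** Real and imaginary parts are summed separately, where absolute convergence is
    available. *)
Lemma taylor_exists (a : nat -> C) (B : R) : (forall k, normc (a k) <= B) ->
  exists F, taylor a F.
Proof.
move=> aB.
have B0 : 0 <= B by exact: le_trans (normc_ge0 _) (aB 0%N).
have /choice[F FP] (z : C) : exists l : C, normc z < 1 ->
    (fun n => (\sum_(k < n) a k * z ^+ k : C^o)) @ \oo --> (l : C^o).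
  have [z1|] := ltP (normc z) 1; last by exists 0.
  have key (P : C -> R) : (forall w, `|P w| <= normc w) ->
      cvgn (series (fun k => P (a k * z ^+ k))).
    move=> Pw; apply: normed_cvg.
    apply: (@series_le_cvg _ _ (geometric B (normc z))).
    - by move=> k; exact: normr_ge0.
    - by move=> k; rewrite /geometric /= mulr_ge0 // exprn_ge0 // normc_ge0.
    - move=> k; apply: le_trans (Pw _) _.
      rewrite ComplexField.Normc.normcM normcX ler_wpM2r // exprn_ge0 //.
      exact: normc_ge0.
    - by apply: is_cvg_geometric_series; rewrite ger0_norm ?normc_ge0.
  have /cvg_ex[/= lr cr] : cvgn (series (fun k => Re (a k * z ^+ k))).
    apply: key => w; rewrite -(@ler_pXn2r _ 2) ?nnegrE ?normc_ge0 //.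
    by rewrite normc_sqrE real_normK ?num_real // lerDl sqr_ge0.
  have /cvg_ex[/= li ci] : cvgn (series (fun k => Im (a k * z ^+ k))).
    apply: key => w; rewrite -(@ler_pXn2r _ 2) ?nnegrE ?normc_ge0 //.
    by rewrite normc_sqrE real_normK ?num_real // lerDr sqr_ge0.
  exists (lr +i* li) => _; apply/ccvgP => e e0.
  have e2 : 0 < e / 2 by rewrite divr_gt0.
  move/cvgrPdist_lt : cr => /(_ _ e2)[N _ NP].
  move/cvgrPdist_lt : ci => /(_ _ e2)[M _ MP].
  exists (maxn N M) => n; rewrite geq_max => /andP[Nn Mn].
  apply: le_lt_trans (normc_le_add _) _; rewrite [e]splitr.
  have ReS : Re (\sum_(k < n) a k * z ^+ k) = \sum_(k < n) Re (a k * z ^+ k).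
    by elim/big_ind2: _ => // x1 x2 y1 y2 <- <-; rewrite ReImE.
  have ImS : Im (\sum_(k < n) a k * z ^+ k) = \sum_(k < n) Im (a k * z ^+ k).
    by elim/big_ind2: _ => // x1 x2 y1 y2 <- <-; rewrite ReImE.
  rewrite !ReImE ReS ImS /= ltrD // distrC.
  - by have := NP n Nn; rewrite /= seriesEord.
  - by have := MP n Mn; rewrite /= seriesEord.
by exists F => z z1; exact: FP.
Qed.

(** At a radius [rho] between [r] and 1 the series converges, so its terms are
    bounded; on the circle of radius [r] it is then dominated by a geometric
    series of ratio [r / rho], uniformly in the angle. *)
Lemma taylor_uniform (a : nat -> C) F (r : R) : taylor a F -> 0 <= r < 1 ->
  forall e : R, 0 < e -> exists N, forall n, (N <= n)%N ->
  forall z, normc z = r -> normc (F z - \sum_(k < n) a k * z ^+ k) <= e.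
Proof.
move=> aF /andP[r0 r1] e e0.
pose S n z := \sum_(k < n) a k * z ^+ k.
pose rho := (1 + r) / 2.
have rho0 : 0 < rho by rewrite /rho; lra.
have rho1 : rho < 1 by rewrite /rho; lra.
have rrho : r < rho by rewrite /rho; lra.
have /ccvgP/(_ 1 ltr01)[N0 N0P] : (fun n => (S n rho%:C : C^o)) @ \oo --> (F rho%:C : C^o).
  by apply: aF; rewrite normc_real gtr0_norm.
have ak k : (N0 <= k)%N -> normc (a k) * rho ^+ k <= 2.
  move=> Nk; have -> : normc (a k) * rho ^+ k = normc (S k.+1 rho%:C - S k rho%:C).
    rewrite /S big_ord_recr /= [_ + a k * _]addrC addrK ComplexField.Normc.normcM normcX.
    by rewrite normc_real gtr0_norm.
  have -> : S k.+1 rho%:C - S k rho%:C =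
    (S k.+1 rho%:C - F rho%:C) + - (S k rho%:C - F rho%:C).
    by rewrite opprB addrA subrK.
  apply: le_trans (le_normcD _ _) _; rewrite normcN.
  have := N0P _ Nk; have := N0P _ (leqW Nk); lra.
pose q := r / rho.
have q0 : 0 <= q by rewrite divr_ge0 // ltW.
have q1 : q < 1 by rewrite ltr_pdivrMr // mul1r.
have tail n d z : (N0 <= n)%N -> normc z = r ->
    normc (S (n + d)%N z - S n z) <= 2 * (q ^+ n - q ^+ (n + d)) / (1 - q).
  move=> Nn zr; elim: d => [|d IH].
    by rewrite addn0 !subrr ComplexField.Normc.normc0 mulr0 mul0r.
  have -> : S (n + d.+1)%N z - S n z = (S (n + d)%N z - S n z) + a (n + d)%N * z ^+ (n + d).
    by rewrite addnS /S big_ord_recr /= addrAC.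
  apply: le_trans (le_normcD _ _) _.
  have -> : 2 * (q ^+ n - q ^+ (n + d.+1)) / (1 - q) =
    2 * (q ^+ n - q ^+ (n + d)) / (1 - q) + 2 * q ^+ (n + d).
    by rewrite addnS exprS; field; rewrite subr_eq0 gt_eqF.
  apply: lerD => //; rewrite ComplexField.Normc.normcM normcX zr.
  have -> : r = rho * q by rewrite /q mulrC divfK // gt_eqF.
  rewrite exprMn mulrA ler_wpM2r ?exprn_ge0 // ak //.
  by rewrite (leq_trans Nn) // leq_addr.
have [N1 _ N1P] : \forall n \near \oo, 2 * q ^+ n / (1 - q) < e.
  have : (2 * q ^+ n / (1 - q) : R) @[n --> \oo] --> 0.
    have h : (q ^+ n : R) @[n --> \oo] --> 0 by apply: cvg_expr; rewrite ger0_norm.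
    have <- : 2 * 0 / (1 - q) = 0 by rewrite mulr0 mul0r.
    by apply: cvgMl; exact: cvgMr.
  by move=> h; apply: cvgr_lt h _ e0.
exists (maxn N0 N1) => n; rewrite geq_max => /andP[N0n N1n] z zr.
apply/ler_addgt0Pr => d d0.
have /ccvgP/(_ d d0)[M MP] : (fun n => (S n z : C^o)) @ \oo --> (F z : C^o).
  by apply: aF; rewrite zr.
have -> : F z - S n z = (S (n + M)%N z - S n z) - (S (n + M)%N z - F z).
  by ring.
apply: le_trans (le_normcD _ _) _; rewrite normcN; apply: lerD.
  apply: le_trans (tail n M z N0n zr) _; apply/ltW; apply: le_lt_trans (N1P n N1n).
  have q1' : 0 <= (1 - q)^-1 by rewrite invr_ge0 subr_ge0 ltW.
  by rewrite ler_wpM2r // ler_wpM2l // lerBlDr lerDl exprn_ge0.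
by apply/ltW/MP; rewrite leq_addl.
Qed.

Lemma taylor_at0 (a : nat -> C) F : taylor a F -> F 0 = a 0%N.
Proof.
move=> aF; apply/eqP; rewrite -subr_eq0; apply/eqP.
apply: ComplexField.Normc.eq0_normc; apply/eqP; rewrite eq_le normc_ge0 andbT.
apply/ler_addgt0Pr => e e0; rewrite add0r.
have [|N NP] := @taylor_uniform a F 0 aF _ e e0; first by rewrite lexx ltr01.
have := NP N.+1 (leqnSn N) 0 (ComplexField.Normc.normc0 R).
rewrite big_ord_recl expr0 mulr1 big1 ?addr0 // => i _.
by rewrite expr0n mulr0.
Qed.

End ComplexSeries.
(** * Hardy functions as limits of polynomials *)

Section HardyCharacterization.
Context {R : realType}.
Local Notation C := R[i].
Local Notation mu := (circle R).
Implicit Types (f g : R -> C) (p q : {poly C}) (F : C -> C).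

Let H := @L2_prehilbert R.

(** The polynomial p(rz). *)
Definition dilate (r : R) p : {poly C} := \poly_(k < size p) (p`_k * r%:C ^+ k).

Lemma size_dilate r p : (size (dilate r p) <= size p)%N.
Proof. exact: size_poly. Qed.

Lemma coef_dilate r p k : (dilate r p)`_k = p`_k * r%:C ^+ k.
Proof.
rewrite coef_poly; case: ltnP => // pk.
by rewrite nth_default // mul0r.
Qed.

Lemma circle_poly_dilate r (a : nat -> C) n t : circle_poly (dilate r (\poly_(k < n) a k)) t =
  \sum_(k < n) a k * (r%:C * cexpi t) ^+ k.
Proof.
have -> : dilate r (\poly_(k < n) a k) = \poly_(k < n) (a k * r%:C ^+ k).
  apply/polyP => k; rewrite coef_dilate !coef_poly.
  by case: ifP => // _; rewrite mul0r.
rewrite /circle_poly horner_poly; apply: eq_bigr => k _.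
by rewrite exprMn mulrA.
Qed.

Lemma sqnorm_bounded f (B : R) : L2 f -> (forall t, normc (f t) <= B) ->
  sqnorm f <= B ^+ 2.
Proof.
move=> /L2P[mf fi] fB.
have -> : B ^+ 2 = \int[mu]_t (B ^+ 2).
  rewrite Rintegral_cst // -[LHS]mulr1; congr (_ * _).
  exact: (congr1 fine (esym (probability_setT (circle R)))).
apply: le_Rintegral => //; first exact: integrable_cst.
move=> t _; rewrite lerXn2r ?nnegrE ?normc_ge0 //.
exact: le_trans (normc_ge0 _) (fB t).
Qed.

Lemma normc_circle (r t : R) : 0 <= r -> normc (r%:C * cexpi t) = r.
Proof.
by move=> r0; rewrite ComplexField.Normc.normcM normc_cexpi mulr1 normc_real ger0_norm.
Qed.

(** On the circle of radius [r] the Taylor polynomials converge uniformly, which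
    gives the measurability and the integrability of the dilate of [F]. *)
Lemma dilate_approx (a : nat -> C) F (r : R) : taylor a F -> 0 <= r < 1 ->
  L2 (fun t => F (r%:C * cexpi t)) /\
  forall e : R, 0 < e -> exists N, forall n, (N <= n)%N ->
    sqnorm (fun t => F (r%:C * cexpi t) - circle_poly (dilate r (\poly_(k < n) a k)) t) <= e.
Proof.
move=> aF /[dup] r01 /andP[r0 r1].
pose P n := circle_poly (dilate r (\poly_(k < n) a k)).
pose Fr t := F (r%:C * cexpi t).
have unif e : 0 < e -> exists N, forall n, (N <= n)%N ->
    forall t, normc (Fr t - P n t) <= e.
  move=> e0; have [N NP] := taylor_uniform aF r01 e0; exists N => n Nn t.
  by rewrite /P circle_poly_dilate; apply: NP => //; exact: normc_circle.
have mP n : cmeasurable (P n) by have /L2P[] := L2_circle_poly (dilate r (\poly_(k < n) a k)).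
have cvgP t : (fun n => (P n t : C^o)) @ \oo --> (Fr t : C^o).
  apply/ccvgP => e e0; have [|N NP] := unif (e / 2); first by rewrite divr_gt0.
  exists N => n Nn; rewrite -normcN opprB; apply: le_lt_trans (NP n Nn t) _.
  by rewrite ltr_pdivrMr // mulr_natr mulr2n ltrDl.
have mFr : cmeasurable Fr.
  have le_part (z : C) : `|Re z| <= normc z /\ `|Im z| <= normc z.
    by split; rewrite -(@ler_pXn2r _ 2) ?nnegrE ?normc_ge0 // normc_sqrE
      real_normK ?num_real // ?lerDl ?lerDr sqr_ge0.
  split.
  - apply: (measurable_fun_cvg (h := fun n t => Re (P n t))).
      by move=> n; case: (mP n).
    move=> t _; apply/cvgrPdist_lt => e e0.
    have /ccvgP/(_ e e0)[N NP] := cvgP t; exists N => // n Nn /=.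
    rewrite distrC; apply: le_lt_trans (NP n Nn).
    by rewrite -Re_opp -Re_add; case: (le_part (P n t - Fr t)).
  - apply: (measurable_fun_cvg (h := fun n t => Im (P n t))).
      by move=> n; case: (mP n).
    move=> t _; apply/cvgrPdist_lt => e e0.
    have /ccvgP/(_ e e0)[N NP] := cvgP t; exists N => // n Nn /=.
    rewrite distrC; apply: le_lt_trans (NP n Nn).
    by rewrite -Im_opp -Im_add; case: (le_part (P n t - Fr t)).
have md n : cmeasurable (fun t => Fr t - P n t).
  rewrite (_ : (fun _ => _) = fun t => -1 * P n t + Fr t).
    exact: cmeasurable_lin.
  by apply/funext => t; rewrite mulN1r addrC.
have LFr : L2 Fr.
  have [N NP] := unif 1 ltr01.
  have := L2_bounded (md N) (NP N (leqnn N)) => Ld.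
  rewrite (_ : Fr = fun t => 1 * (Fr t - P N t) + P N t).
    by apply: L2_lin => //; exact: L2_circle_poly.
  by apply/funext => t; rewrite mul1r subrK.
split=> // e e0.
have [|N NP] := unif (Num.sqrt e); first by rewrite sqrtr_gt0.
exists N => n Nn; rewrite -[e in _ <= e]sqr_sqrtr ?(ltW e0) //.
apply: sqnorm_bounded; last exact: NP.
exact: (ph_sub H LFr (L2_circle_poly _)).
Qed.

Lemma near_left1 : \forall r \near (1 : R)^'-, 0 <= r < 1.
Proof.
near=> r; apply/andP; split; near: r; first exact: nbhs_left_ge.
exact: nbhs_left_lt.
Unshelve. all: by end_near. Qed.

Lemma quasi_triangle f g h : L2 f -> L2 g -> L2 h ->
  sqnorm (fun t => f t - h t) <=
  2 * sqnorm (fun t => f t - g t) + 2 * sqnorm (fun t => g t - h t).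
Proof. by move=> Lf Lg Lh; have := sqn_quasi H Lf Lg Lh; rewrite !sqn_L2. Qed.

Lemma sqnorm_subC f g : L2 f -> L2 g ->
  sqnorm (fun t => f t - g t) = sqnorm (fun t => g t - f t).
Proof. by move=> Lf Lg; have := sqnN H Lf Lg; rewrite !sqn_L2. Qed.

(** A dilate of [F] is close to the boundary function, and a Taylor polynomial of
    [F] is close to the dilate.  The value at 0 is kept because every Taylor
    polynomial of positive length and every dilation preserve it. *)
Lemma boundary_function_approx (a : nat -> C) F f : taylor a F ->
  boundary_function F f -> forall e : R, 0 < e ->
  exists2 p, p.[0] = F 0 & sqnorm (fun t => f t - circle_poly p t) < e.
Proof.
move=> aF [Lf bf] e e0.
have LF : \forall r \near (1 : R)^'-, L2 (fun t => F (r%:C * cexpi t) - f t).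
  by apply: filterS near_left1 => r /(dilate_approx aF)[LFr _]; exact: (ph_sub H).
move/(sqnorm_cvg_L2norm LF) : bf => bf.
have e8 : 0 < e / 8 by rewrite divr_gt0.
have [r [r01 fr]] := filter_ex (filterI near_left1 (@cvgr_lt _ _ _ _ _ _ bf _ e8)).
have [LFr /(_ _ e8)[N NP]] := dilate_approx aF r01.
exists (dilate r (\poly_(k < N.+1) a k)).
  by rewrite horner_coef0 coef_dilate coef_poly expr0 mulr1 (taylor_at0 aF).
have := NP N.+1 (leqnSn N) => {}NP.
apply: le_lt_trans (quasi_triangle Lf LFr (L2_circle_poly _)) _.
by rewrite (sqnorm_subC Lf LFr); lra.
Qed.

Definition poly_approx f : Prop :=
  forall e : R, 0 < e -> exists p, sqnorm (fun t => f t - circle_poly p t) < e.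

Lemma sqnorm_dilate_le (r : R) p : 0 <= r <= 1 ->
  sqnorm (circle_poly (dilate r p)) <= sqnorm (circle_poly p).
Proof.
move=> /andP[r0 r1].
rewrite (parseval_circle_poly (size_dilate r p)) (parseval_circle_poly (leqnn _)).
apply: ler_sum => k _.
rewrite coef_dilate ComplexField.Normc.normcM normcX normc_real ger0_norm //.
by rewrite exprMn ler_piMr ?sqr_ge0 // exprn_ile1 ?exprn_ge0 // exprn_ile1.
Qed.

Lemma dilate_sub (r : R) p q : dilate r (p - q) = dilate r p - dilate r q.
Proof. by apply/polyP => k; rewrite coefB !coef_dilate coefB mulrBl. Qed.

Lemma circle_poly_sub p q t : circle_poly (p - q) t = circle_poly p t - circle_poly q t.
Proof. by rewrite /circle_poly hornerD hornerN. Qed.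

(** By Parseval the left-hand side is a real polynomial in [r] that vanishes
    at 1. *)
Lemma dilate_cvg p : sqnorm (fun t => circle_poly (dilate r p) t - circle_poly p t) @[r --> (1 : R)^'-] --> 0.
Proof.
pose h : {poly R} := \sum_(k < size p) (normc p`_k ^+ 2) *: ('X^k - 1) ^+ 2.
have -> : (fun r : R => sqnorm (fun t => circle_poly (dilate r p) t - circle_poly p t)) = fun r => h.[r].
  apply/funext => r.
  have -> : (fun t => circle_poly (dilate r p) t - circle_poly p t) = circle_poly (dilate r p - p).
    by apply/funext => t; rewrite circle_poly_sub.
  rewrite (@parseval_circle_poly _ _ (size p)).
    rewrite horner_sum; apply: eq_bigr => k _.
    rewrite coefB coef_dilate hornerZ horner_exp hornerD hornerN hornerXn hornerC.
    rewrite -[X in _ - X]mulr1 -mulrBr ComplexField.Normc.normcM exprMn.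
    congr (_ * _).
    have -> : r%:C ^+ k - 1 = (r ^+ k - 1)%:C.
      by rewrite (rmorphB (real_complex R)) (rmorphXn (real_complex R)).
    by rewrite normc_real real_normK ?num_real.
  rewrite (leq_trans (size_polyD _ _)) // size_polyN geq_max leqnn andbT.
  exact: size_dilate.
have <- : h.[1] = 0.
  rewrite horner_sum big1 // => k _.
  by rewrite hornerZ horner_exp hornerD hornerN hornerXn hornerC expr1n subrr expr0n mulr0.
apply: cvg_at_left_filter; exact: continuous_horner.
Qed.

(** The Fourier coefficients of [f] define [F].  If a polynomial [p] approximates
    [f], then so do the Fourier sums [s] of large degree; as dilations contract,
    the dilate of [s] stays near that of [p], which tends to [p] as [r] tends
    to 1. *)
Lemma approx_H2 f : L2 f -> poly_approx f -> H2 f.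
Proof.
move=> Lf fa; pose a k := L2inner f (trig k).
have aB k : normc (a k) <= Num.sqrt (sqnorm f).
  rewrite -(@ler_pXn2r _ 2) ?nnegrE ?normc_ge0 ?sqrtr_ge0 //.
  rewrite (sqr_sqrtr (sqnorm_ge0 f)); apply: le_trans _ (bessel k.+1 Lf).
  by rewrite big_ord_recr /= lerDr; apply: sumr_ge0 => i _; exact: sqr_ge0.
have [F aF] := taylor_exists aB.
exists F.
  exists a => //; apply: nondecreasing_is_cvgn.
    apply/nondecreasing_seqP => n; rewrite seriesEord /= big_ord_recr /= lerDl.
    exact: sqr_ge0.
  exists (sqnorm f) => _ [n _ <-]; rewrite seriesEord; exact: bessel.
have LF : \forall r \near (1 : R)^'-, L2 (fun t => F (r%:C * cexpi t) - f t).
  by apply: filterS near_left1 => r /(dilate_approx aF)[LFr _]; exact: (ph_sub H).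
split=> //; apply: (sqnorm_cvg_L2norm LF).2.
apply/cvgrPdist_lt => e e0.
(* three triangle inequalities produce 2 + 4 + 8 + 8 errors below e / 64 *)
have e0' : 0 < e / 64 by rewrite divr_gt0.
have [p fp] := fa _ e0'.
have pr := @cvgr_lt _ _ _ _ _ _ (dilate_cvg p) _ e0'.
near=> r.
have r01 : 0 <= r < 1 by near: r; exact: near_left1.
have /andP[r0 r1] := r01.
have rp : sqnorm (fun t => circle_poly (dilate r p) t - circle_poly p t) < e / 64.
  by near: r; exact: pr.
have [LFr /(_ _ e0')[N NP]] := dilate_approx aF r01.
rewrite sub0r normrN ger0_norm ?sqnorm_ge0 //.
pose M := maxn N (size p).
have := NP M (leq_maxl _ _); set s := fourier_poly f M => {}NP.
have sp : sqnorm (fun t => circle_poly (dilate r s) t - circle_poly (dilate r p) t) < e / 64.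
  have -> : (fun t => circle_poly (dilate r s) t - circle_poly (dilate r p) t)
      = circle_poly (dilate r (s - p)).
    by apply/funext => t; rewrite dilate_sub circle_poly_sub.
  apply: le_lt_trans fp; apply: le_trans (sqnorm_dilate_le _ _) _.
    by rewrite r0 ltW.
  by rewrite (fourier_best Lf (leq_maxr N (size p))) lerDr sqnorm_ge0.
have t1 := quasi_triangle LFr (L2_circle_poly (dilate r s)) Lf.
have t2 := quasi_triangle (L2_circle_poly (dilate r s)) (L2_circle_poly (dilate r p)) Lf.
have t3 := quasi_triangle (L2_circle_poly (dilate r p)) (L2_circle_poly p) Lf.
rewrite (sqnorm_subC (L2_circle_poly p) Lf) in t3.
rewrite -/(fourier_poly f M) -/s in NP.
move: t1 t2 t3 NP sp rp fp.
set x1 := sqnorm _; set x2 := sqnorm _; set x3 := sqnorm _.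
set x4 := sqnorm _; set x5 := sqnorm _; set x6 := sqnorm _.
by set x7 := sqnorm _; lra.
Unshelve. all: by end_near. Qed.

Theorem H2P f : H2 f <-> L2 f /\ poly_approx f.
Proof.
split=> [[F [a _ aF] bF]|[]]; last exact: approx_H2.
split; first by case: bF.
move=> e e0; have [p _ fp] := boundary_function_approx aF bF e0; by exists p.
Qed.

Lemma mean_sub_le f g : L2 f -> L2 g ->
  normc (cintegral f - cintegral g) ^+ 2 <= sqnorm (fun t => f t - g t).
Proof.
move=> Lf Lg; rewrite !cintegral_inner1 -(ip_sub H Lf Lg (L2_cst 1)).
have Lfg : L2 (fun t => f t - g t) by exact: (ph_sub H).
have := cauchy_schwarz H Lfg (L2_cst 1).
rewrite !sqn_L2; have -> : sqnorm (fun=> 1 : C) = 1; last by rewrite mulr1.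
rewrite -[fun=> 1]/(trig 0); apply: complexI.
by rewrite -L2inner_sqnorm trig_orthonormal.
Qed.

(** The polynomials that approximate [f] share their value at 0 with the function
    on the disc, and that value is their mean. *)
Lemma at0E f : H2 f -> at0 f = cintegral f.
Proof.
move=> [F hF bF].
have [[a _ aD] bD] : hardy2_disc (disc_function f) /\ boundary_function (disc_function f) f.
  by apply: (@xgetPex _ (fun=> 0) [set F | hardy2_disc F /\ boundary_function F f]); exists F.
have Lf : L2 f by case: bF.
apply/eqP; rewrite eq_sym -subr_eq0; apply/eqP; apply: ComplexField.Normc.eq0_normc.
apply/eqP; rewrite -sqrf_eq0 eq_le sqr_ge0 andbT.
apply/ler_addgt0Pr => e e0; rewrite add0r.
have [p p0 fp] := boundary_function_approx aD bD e0.
rewrite /at0 -p0 -cintegral_circle_poly; apply: le_trans (mean_sub_le Lf (L2_circle_poly p)) _.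
exact: ltW.
Qed.

End HardyCharacterization.
(** * Operations on the Hardy space *)

Section HardyOperations.
Context {R : realType}.
Local Notation C := R[i].
Local Notation mu := (circle R).
Implicit Types (f g k : R -> C) (p q : {poly C}).

Let H := @L2_prehilbert R.

Lemma H2_L2 f : H2 f -> L2 f. Proof. by case/H2P. Qed.

Lemma L2_measurable f : L2 f -> cmeasurable f. Proof. by case/L2P. Qed.

Lemma cmeasurable_sub f g : cmeasurable f -> cmeasurable g ->
  cmeasurable (fun t => f t - g t).
Proof.
move=> mf mg; rewrite (_ : (fun _ => _) = fun t => -1 * g t + f t).
  exact: cmeasurable_lin.
by apply/funext => t; rewrite mulN1r addrC.
Qed.

Lemma H2_ae f g : {ae mu, forall t, f t = g t} -> H2 f -> cmeasurable g -> H2 g.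
Proof.
move=> fg /H2P[Lf fa] mg; apply/H2P; split; first exact: L2_ae fg Lf mg.
move=> e e0; have [p fp] := fa e e0; exists p.
have mp : cmeasurable (circle_poly p) by exact/L2_measurable/L2_circle_poly.
rewrite (_ : sqnorm _ = sqnorm (fun t => f t - circle_poly p t)) //.
apply: sqnorm_ae; try exact: cmeasurable_sub (L2_measurable Lf) mp.
  by apply: (ae_imp _ fg) => t ->.
exact: cmeasurable_sub.
Qed.

Lemma H2_circle_poly p : H2 (circle_poly p).
Proof.
apply/H2P; split; first exact: L2_circle_poly.
move=> e e0; exists p; rewrite (_ : (fun _ => _) = circle_poly 0).
  by rewrite (@parseval_circle_poly _ _ 0) ?big_ord0 // size_poly0.
by apply/funext => t; rewrite subrr /circle_poly horner0.
Qed.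

Lemma H2_closed (u : nat -> R -> C) f : (forall n, H2 (u n)) -> L2 f ->
  sqnorm (fun t => u n t - f t) @[n --> \oo] --> 0 -> H2 f.
Proof.
move=> Hu Lf uf; apply/H2P; split => // e e0.
have e4 : 0 < e / 4 by rewrite divr_gt0.
have [N _ NP] := @cvgr_lt _ _ _ _ _ _ uf _ e4.
have := NP N (leqnn N) => /= {}NP.
have /H2P[Lu /(_ _ e4)[p up]] := Hu N; exists p.
apply: le_lt_trans (quasi_triangle Lf Lu (L2_circle_poly p)) _.
by rewrite (sqnorm_subC Lf Lu); lra.
Qed.

Lemma H2_lin c f g : H2 f -> H2 g -> H2 (fun t => c * f t + g t).
Proof.
move=> /H2P[Lf fa] /H2P[Lg ga]; apply/H2P; split; first exact: L2_lin.
move=> e e0.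
have b0 : 0 < 1 + normc c ^+ 2 by rewrite ltr_pwDl // sqr_ge0.
have e1 : 0 < e / 4 / (1 + normc c ^+ 2) by rewrite !divr_gt0.
have e4 : 0 < e / 4 by rewrite divr_gt0.
have [p fp] := fa _ e1; have [q gq] := ga _ e4.
exists (c *: p + q).
have Lfp : L2 (fun t => f t - circle_poly p t) by exact: (ph_sub H Lf (L2_circle_poly p)).
have Lgq : L2 (fun t => g t - circle_poly q t) by exact: (ph_sub H Lg (L2_circle_poly q)).
have Lm : L2 (fun t => c * (circle_poly p t - f t) + circle_poly q t).
  apply: L2_lin; last exact: L2_circle_poly.
  exact: (ph_sub H (L2_circle_poly p) Lf).
have := parallelogram H (ph_scale H c Lfp) Lgq; rewrite (sqnZ H _ Lfp) !sqn_L2.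
have -> : (c *: ((fun t => f t - circle_poly p t) : R -> C^o) + (fun t => g t - circle_poly q t))
    = fun t => c * f t + g t - circle_poly (c *: p + q) t.
  apply/funext => t; rewrite -[LHS]/(c * (f t - circle_poly p t) + (g t - circle_poly q t)).
  by rewrite /circle_poly hornerD hornerZ; ring.
have : normc c ^+ 2 * sqnorm (fun t => f t - circle_poly p t) <= e / 4.
  apply: (@le_trans _ _ ((1 + normc c ^+ 2) * sqnorm (fun t => f t - circle_poly p t))).
    by rewrite ler_wpM2r ?sqnorm_ge0 // lerDr.
  by rewrite mulrC -ler_pdivlMr // ltW.
have := sqnorm_ge0 (c *: ((fun t => f t - circle_poly p t) : R -> C^o) -
  ((fun t => g t - circle_poly q t) : R -> C^o)).
lra.
Qed.

Lemma sqnorm_unimodular u f : {ae mu, forall t, normc (u t) = 1} ->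
  cmeasurable u -> L2 f -> sqnorm (fun t => u t * f t) = sqnorm f.
Proof.
move=> u1 mu_ Lf; rewrite /sqnorm /Rintegral; congr fine.
apply: ae_eq_integral => //.
- apply/measurable_EFinP; apply: cmeasurable_sqr; apply: cmeasurable_mul => //.
  exact: L2_measurable.
- by apply/measurable_EFinP; apply: cmeasurable_sqr; exact: L2_measurable.
- apply: (ae_imp _ u1) => t ut _.
  by rewrite ComplexField.Normc.normcM ut mul1r.
Qed.

Lemma sqnorm_cexpi_mul f : L2 f -> sqnorm (fun t => cexpi t * f t) = sqnorm f.
Proof.
apply: sqnorm_unimodular; last exact: cmeasurable_cexpi.
by apply: aeW => t; exact: normc_cexpi.
Qed.

Lemma sqnorm_cexpi_conj_mul f : L2 f ->
  sqnorm (fun t => conjc (cexpi t) * f t) = sqnorm f.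
Proof.
apply: sqnorm_unimodular; last exact/cmeasurable_conj/cmeasurable_cexpi.
by apply: aeW => t; rewrite normc_conj normc_cexpi.
Qed.

Lemma H2_shift f : H2 f -> H2 (fun t => cexpi t * f t).
Proof.
move=> /H2P[Lf fa]; apply/H2P; split; first exact: L2_cexpi_mul.
move=> e e0; have [p fp] := fa e e0; exists (p * 'X + 0%:P).
rewrite circle_poly_MXaddC (_ : (fun _ => _) = fun t => cexpi t * (f t - circle_poly p t)).
  by rewrite sqnorm_cexpi_mul //; exact: (ph_sub H Lf (L2_circle_poly p)).
by apply/funext => t; rewrite addr0 mulrBr.
Qed.

Lemma mean_shift f : H2 f -> cintegral (fun t => cexpi t * f t) = 0.
Proof.
move=> /H2P[Lf fa]; apply: ComplexField.Normc.eq0_normc.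
apply/eqP; rewrite -sqrf_eq0 eq_le sqr_ge0 andbT.
apply/ler_addgt0Pr => e e0; rewrite add0r.
have [p fp] := fa e e0; pose q := p * 'X + 0%:P.
have q0 : cintegral (circle_poly q) = 0 by rewrite cintegral_circle_poly !hornerE.
have := mean_sub_le (L2_cexpi_mul Lf) (L2_circle_poly q); rewrite q0 subr0 => h.
apply: le_trans h _; apply/ltW.
rewrite circle_poly_MXaddC (_ : (fun _ => _) = fun t => cexpi t * (f t - circle_poly p t)).
  by rewrite sqnorm_cexpi_mul //; exact: (ph_sub H Lf (L2_circle_poly p)).
by apply/funext => t; rewrite addr0 mulrBr.
Qed.

(** Near [f], a polynomial has a small constant term, since its mean is close to
    that of [f]; what remains is divisible by the variable. *)
Lemma H2_backshift f : H2 f -> cintegral f = 0 ->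
  H2 (fun t => conjc (cexpi t) * f t).
Proof.
move=> /H2P[Lf fa] f0; apply/H2P; split; first exact: L2_cexpi_conj_mul.
move=> e e0; have e4 : 0 < e / 4 by rewrite divr_gt0.
have [p fp] := fa _ e4; pose q := \poly_(k < size p) p`_k.+1.
have pE : p = q * 'X + (p`_0)%:P.
  apply/polyP => -[|k]; first by rewrite coefD coefMX coefC /= add0r.
  rewrite coefD coefMX coefC /= addr0 coef_poly; case: ltnP => // pk.
  by rewrite nth_default // ltnW.
have p0 : normc p`_0 ^+ 2 < e / 4.
  have := mean_sub_le Lf (L2_circle_poly p).
  rewrite f0 cintegral_circle_poly horner_coef0 sub0r normcN => h.
  exact: le_lt_trans h fp.
exists q.
have Lfp : L2 (fun t => f t - circle_poly p t) by exact: (ph_sub H Lf (L2_circle_poly p)).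
have Lfq : L2 (fun t => f t - cexpi t * circle_poly q t).
  exact: (ph_sub H Lf (L2_cexpi_mul (L2_circle_poly q))).
have -> : (fun t => conjc (cexpi t) * f t - circle_poly q t) =
    fun t => conjc (cexpi t) * (f t - cexpi t * circle_poly q t).
  apply/funext => t; rewrite mulrBr mulrA [conjc _ * cexpi t]mulrC.
  by rewrite cexpi_conj mul1r.
rewrite (sqnorm_cexpi_conj_mul Lfq).
have := quasi_triangle Lf (L2_circle_poly p) (L2_cexpi_mul (L2_circle_poly q)).
have -> : (fun t => circle_poly p t - cexpi t * circle_poly q t) = circle_poly (p`_0)%:P.
  by apply/funext => t; rewrite [in LHS]pE circle_poly_MXaddC /circle_poly hornerC addrC addrA addNr add0r.
rewrite (@parseval_circle_poly _ _ 1) ?size_polyC_leq1 // big_ord_recl big_ord0 addr0 coefC /=.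
lra.
Qed.

End HardyOperations.

(** * The model space *)


Section ModelSpace.
Context {R : realType}.
Local Notation C := R[i].
Local Notation mu := (circle R).
Variable theta : R -> C.
Hypothesis htheta : inner_function theta.
Implicit Types (f g k : R -> C).

Let H := @L2_prehilbert R.

Lemma H2_inner : H2 theta.
Proof.
case: htheta => -[F [[a aT] _] bT] _; apply/H2P; split; first by case: bT.
move=> e e0; have [p _ fp] := boundary_function_approx aT bT e0; by exists p.
Qed.

Let theta1 : {ae mu, forall t, normc (theta t) = 1}.
Proof. by case: htheta. Qed.

Let mtheta : cmeasurable theta := L2_measurable (H2_L2 H2_inner).

(** The conjugation of the model space: an antilinear isometric involution. *)
Definition twist f : R -> C := fun t => theta t * conjc (f t).

Lemma L2_twist f : L2 f -> L2 (twist f).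
Proof.
move=> Lf; apply: (@L2_mul R 1) => //; last exact: L2_conj.
by apply: (ae_imp _ theta1) => t ->.
Qed.

Lemma sqnorm_conj f : sqnorm (fun t => conjc (f t)) = sqnorm f.
Proof. by apply: eq_Rintegral => t _; rewrite normc_conj. Qed.

Lemma sqnorm_twist f : L2 f -> sqnorm (twist f) = sqnorm f.
Proof.
by move=> Lf; rewrite (sqnorm_unimodular theta1 mtheta (L2_conj Lf)) sqnorm_conj.
Qed.

Lemma twist_ae f h : {ae mu, forall t, f t = twist h t} ->
  {ae mu, forall t, h t = twist f t}.
Proof.
move=> fh; apply: (ae_imp2 _ fh theta1) => t; rewrite /twist => -> t1.
by rewrite rmorphM /= conjcK mulrA mulr_conjc t1 expr1n mul1r.
Qed.

(** As [theta] is unimodular, the function [h] in the definition of the model space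
    can only be [theta conj f]. *)
Lemma model_spaceP f : model_space theta f <->
  [/\ H2 f, H2 (twist f) & cintegral (twist f) = 0].
Proof.
split=> [[Hf [h [Hh h0 fh]]]|[Hf Ht t0]].
- have mt := L2_measurable (L2_twist (H2_L2 Hf)).
  have ht := twist_ae fh; split=> //; first exact: H2_ae ht Hh mt.
  rewrite -h0 at0E //; apply/esym; apply: cintegral_ae => //.
  exact: L2_measurable (H2_L2 Hh).
- split=> //; exists (twist f); split=> //; first by rewrite at0E.
  by apply: twist_ae; apply: aeW.
Qed.

Lemma model_space_L2 f : model_space theta f -> L2 f.
Proof. by case/model_spaceP => /H2_L2. Qed.

Lemma cintegral_lin_L2 c f g : L2 f -> L2 g ->
  cintegral (fun t => c * f t + g t) = c * cintegral f + cintegral g.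
Proof.
move=> Lf Lg; rewrite !cintegral_inner1.
exact: (ip_lin H c Lf Lg (L2_cst 1)).
Qed.

Lemma model_space_lin c f g : model_space theta f -> model_space theta g ->
  model_space theta (fun t => c * f t + g t).
Proof.
move=> /model_spaceP[Hf Tf f0] /model_spaceP[Hg Tg g0]; apply/model_spaceP.
have -> : twist (fun t => c * f t + g t) =
    fun t => conjc c * twist f t + twist g t.
  by apply/funext => t; rewrite /twist rmorphD rmorphM /=; ring.
split; [exact: H2_lin | exact: H2_lin |].
by rewrite cintegral_lin_L2 ?f0 ?g0 ?mulr0 ?addr0 //; exact: H2_L2.
Qed.

Lemma cvg_mean0 (u : nat -> R -> C) f : (forall n, L2 (u n)) -> L2 f ->
  (forall n, cintegral (u n) = 0) ->
  sqnorm (fun t => u n t - f t) @[n --> \oo] --> 0 -> cintegral f = 0.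
Proof.
move=> Lu Lf u0 uf; apply: ComplexField.Normc.eq0_normc.
apply/eqP; rewrite -sqrf_eq0 eq_le sqr_ge0 andbT.
apply: (cvgr_to_ge uf); apply: nearW => n.
by have := mean_sub_le (Lu n) Lf; rewrite u0 sub0r normcN.
Qed.

Lemma model_space_closed (u : nat -> R -> C) f :
  (forall n, model_space theta (u n)) -> L2 f ->
  sqnorm (fun t => u n t - f t) @[n --> \oo] --> 0 -> model_space theta f.
Proof.
move=> Ku Lf uf; apply/model_spaceP.
have Lu n : L2 (u n) by exact: model_space_L2.
have tf : sqnorm (fun t => twist (u n) t - twist f t) @[n --> \oo] --> 0.
  rewrite (_ : (fun n => _) = fun n => sqnorm (fun t => u n t - f t)) //.
  apply/funext => n; rewrite -(sqnorm_twist (ph_sub H (Lu n) Lf)).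
  congr sqnorm; apply/funext => t.
  by rewrite /twist -mulrBr -rmorphB.
split.
- by apply: (H2_closed _ Lf uf) => n; case/model_spaceP: (Ku n).
- by apply: (H2_closed _ (L2_twist Lf) tf) => n; case/model_spaceP: (Ku n).
- apply: (cvg_mean0 _ (L2_twist Lf) _ tf) => n; first exact: L2_twist.
  by case/model_spaceP: (Ku n).
Qed.

(** The conjugation exchanges multiplication by [conj z] with multiplication by
    [z], which always maps Hardy functions to Hardy functions of mean 0. *)
Lemma model_space_backshift f : model_space theta f -> cintegral f = 0 ->
  model_space theta (fun t => conjc (cexpi t) * f t).
Proof.
move=> /model_spaceP[Hf Tf t0] f0; apply/model_spaceP.
have -> : twist (fun t => conjc (cexpi t) * f t) = fun t => cexpi t * twist f t.
  by apply/funext => t; rewrite /twist conjcM conjcK; ring.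
by split; [exact: H2_backshift | exact: H2_shift | exact: mean_shift].
Qed.

(** After conjugation, multiplication by [z] is a backward shift, so the only
    condition that can fail is that the result has mean 0. *)
Lemma model_space_shift f : model_space theta f ->
  cintegral (fun t => conjc (cexpi t) * twist f t) = 0 ->
  model_space theta (fun t => cexpi t * f t).
Proof.
move=> /model_spaceP[Hf Tf t0] f0; apply/model_spaceP.
have -> : twist (fun t => cexpi t * f t) = fun t => conjc (cexpi t) * twist f t.
  by apply/funext => t; rewrite /twist conjcM; ring.
by split; [exact: H2_shift | exact: H2_backshift |].
Qed.

Lemma inner_theta f : model_space theta f -> L2inner theta f = 0.
Proof. by case/model_spaceP. Qed.

End ModelSpace.
(** * Kernels of truncated Toeplitz operators *)

Section KernelDescription.
Context {R : realType} {n : nat}.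
Local Notation C := R[i].
Local Notation mu := (circle R).
Local Notation vfun := (R -> 'cV[C]_n).
Variables (theta : R -> C) (G : R -> 'M[C]_n).
Hypothesis htheta : inner_function theta.
Hypothesis hG : forall i j, Linf (fun t => G t i j).
Implicit Types (X Y : vfun) (f g k : R -> C).

Let H := @L2_prehilbert R.
Let Hn := @vinner_prehilbert R n.
Local Notation K := (model_space theta).

Lemma Linf_mul g f : Linf g -> L2 f -> L2 (fun t => g t * f t).
Proof.
have pos : (0 < circle R setT)%E by rewrite probability_setT lte01.
move=> [mg]; rewrite /Linfnorm unlock ifT; last exact: pos.
set s := ess_sup _ _ => sy.
apply: (@L2_mul R (fine s)) => //.
have := ess_sup_ge mu (abse \o (EFin \o (fun t => normc (g t)))).
apply: ae_imp => t /=; rewrite -/s.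
case: s sy => [r _|//|_]; rewrite ger0_norm ?normc_ge0 //.
Qed.

Lemma Linf_conj g : Linf g -> Linf (fun t => conjc (g t)).
Proof.
move=> [mg gy]; split; first exact: cmeasurable_conj.
by rewrite /Linfnorm; under eq_Lnorm do rewrite /= normc_conj.
Qed.

Lemma sqnorm_eq0 f : L2 f -> sqnorm f = 0 -> {ae mu, forall t, f t = 0}.
Proof.
move=> Lf f0.
have mf : measurable_fun setT (EFin \o (fun t => normc (f t) ^+ 2)).
  by apply/measurable_EFinP; apply: cmeasurable_sqr; exact: L2_measurable.
have : (\int[mu]_t `|(EFin \o (fun t => normc (f t) ^+ 2)%R) t| = 0)%E.
  under eq_integral do rewrite /= ger0_norm ?sqr_ge0 //.
  by rewrite L2_sqnormE // f0.
move=> /(ae_eq_integral_abs mu measurableT mf) f20.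
apply: (ae_imp _ f20) => t /(_ I) [] /eqP; rewrite sqrf_eq0 => /eqP.
exact: ComplexField.Normc.eq0_normc.
Qed.

Lemma inner_ae0 f k : L2 f -> L2 k -> {ae mu, forall t, f t = 0} ->
  L2inner f k = 0.
Proof.
move=> Lf Lk f0; rewrite /L2inner -[RHS](_ : cintegral (fun=> 0 : C) = 0).
  apply: cintegral_ae; first by apply: (ae_imp _ f0) => t ->; rewrite mul0r.
    by apply: cmeasurable_mul; [exact: L2_measurable |
      apply: cmeasurable_conj; exact: L2_measurable].
  exact: cmeasurable_cst.
by apply: complex_ext; rewrite /= Rintegral_cst // mul0r.
Qed.

Lemma vinner_ae0 X Y : vec_of (@L2 R) X -> vec_of (@L2 R) Y ->
  {ae mu, forall t, X t = 0} -> vinner X Y = 0.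
Proof.
move=> LX LY X0; rewrite /vinner big1 // => i _; apply: inner_ae0 => //.
by apply: (ae_imp _ X0) => t Xt; rewrite /coord Xt mxE.
Qed.

Lemma model_space0 : K (fun=> 0).
Proof.
apply/(model_spaceP htheta).
have z0 : H2 (fun=> 0 : C).
  by have := H2_circle_poly (0 : {poly C}); congr H2; apply/funext => t; rewrite /circle_poly horner0.
have -> : twist theta (fun=> 0) = fun=> 0.
  by apply/funext => t; rewrite /twist conjc0 mulr0.
split=> //; rewrite cintegral_inner1; apply: inner_ae0; try exact: L2_cst.
by apply: aeW.
Qed.

(** The choice in the definition of the projection is not vacuous: the Hilbert
    projection is applied to functions with values in vectors of length 1. *)
Lemma orth_projP f : L2 f -> K (orth_proj K f) /\
  forall k, K k -> L2inner (fun t => f t - orth_proj K f t) k = 0.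
Proof.
move=> Lf.
apply: (@xgetPex _ (fun=> 0)
  [set p | K p /\ forall k, K k -> L2inner (fun t => f t - p t) k = 0]).
pose col (h : R -> C) : R -> 'cV[C]_1 := fun t => (h t)%:M.
have coordE h i : coord (col h) i = h.
  by apply/funext => t; rewrite /coord /col mxE ord1 mulr1n.
have [|||||P KP orthP] := @vec_L2_projection R 1 (vec_of K) _ _ _ _ (col f) _.
- by move=> X KX i; exact: (model_space_L2 htheta (KX i)).
- by exists (col (fun=> 0)) => i; rewrite coordE; exact: model_space0.
- by move=> c X Y KX KY i; rewrite coord_lin; exact: (model_space_lin htheta).
- move=> u X Ku LX uX i; apply: (model_space_closed htheta (u := fun m => coord (u m) i)) => //.
    by move=> m; exact: Ku.
  apply: (sqnorm_cvg_L2norm _).1; last exact: uX.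
  by apply: nearW => m; apply: (ph_sub H); [exact/(model_space_L2 htheta)/Ku | exact: LX].
- by move=> i; rewrite coordE.
exists (coord P ord0); split; first exact: KP.
move=> k Kk; have := orthP (col k).
rewrite /vinner big_ord1 coord_sub !coordE; apply.
by move=> i; rewrite coordE.
Qed.

Lemma coord_mulmx X i :
  coord (fun s => G s *m X s) i = fun t => \sum_(j < n) G t i j * coord X j t.
Proof. by apply/funext => t; rewrite /coord mxE. Qed.

(** The adjoint of [X |-> (G X)_i].  It turns each condition on [G X] into the
    vanishing of one continuous functional of [X]. *)
Definition row_adjoint i k : vfun := fun t => \col_j (conjc (G t i j) * k t).

Lemma coord_row_adjoint i k j :
  coord (row_adjoint i k) j = fun t => conjc (G t i j) * k t.
Proof. by apply/funext => t; rewrite /coord mxE. Qed.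

Lemma L2_row_adjoint i k : L2 k -> vec_of (@L2 R) (row_adjoint i k).
Proof.
by move=> Lk j; rewrite coord_row_adjoint; apply: Linf_mul => //; exact: Linf_conj.
Qed.

Lemma mulmx_sumE X i : coord (fun s => G s *m X s) i =
  (\sum_(j < n) 1 *: ((fun t => G t i j * coord X j t) : R -> C^o) : R -> C).
Proof.
rewrite coord_mulmx fct_sumE; apply/funext => t.
by apply: eq_bigr => j _; rewrite scale1r.
Qed.

Lemma L2_mulmx X i : vec_of (@L2 R) X -> L2 (coord (fun s => G s *m X s) i).
Proof.
move=> LX; rewrite mulmx_sumE; apply: (ph_sum H _ (L2_cst 0)) => j.
by apply: Linf_mul => //; exact: LX.
Qed.

Lemma inner_row_adjoint X i k : vec_of (@L2 R) X -> L2 k ->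
  L2inner (coord (fun s => G s *m X s) i) k = vinner X (row_adjoint i k).
Proof.
move=> LX Lk; rewrite mulmx_sumE (ip_sum H _ Lk) => [|j]; last first.
  by apply: Linf_mul => //; exact: LX.
apply: eq_bigr => j _; rewrite mul1r coord_row_adjoint; congr cintegral.
by apply/funext => t; rewrite conjcM conjcK; ring.
Qed.

Lemma vec_model_L2 X : vec_of K X -> vec_of (@L2 R) X.
Proof. by move=> KX i; exact: (model_space_L2 htheta). Qed.

Lemma ker_toeplitzP X : ker_truncated_toeplitz theta G X <->
  vec_of K X /\ forall i k, K k -> vinner X (row_adjoint i k) = 0.
Proof.
split=> -[KX hX]; have LX := vec_model_L2 KX; split => //.
- move=> i k Kk; have Lk := model_space_L2 htheta Kk.
  rewrite -inner_row_adjoint //.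
  have [Kp orthp] := orth_projP (L2_mulmx i LX).
  have Lp := model_space_L2 htheta Kp.
  have := orthp k Kk; rewrite (ip_sub H (L2_mulmx i LX) Lp Lk).
  rewrite (inner_ae0 Lp Lk) ?subr0 //.
  apply: (ae_imp _ hX) => t /colP/(_ i); rewrite !mxE.
  exact.
- have ti i : {ae mu, forall t, orth_proj K (coord (fun s => G s *m X s) i) t = 0}.
    have [Kp orthp] := orth_projP (L2_mulmx i LX).
    have Lp := model_space_L2 htheta Kp.
    apply: sqnorm_eq0 => //; apply: complexI; rewrite -L2inner_sqnorm.
    have := orthp _ Kp; rewrite (ip_sub H (L2_mulmx i LX) Lp Lp).
    by rewrite inner_row_adjoint // hX // sub0r => /eqP; rewrite oppr_eq0 => /eqP.
  have := @filter_forall _ 'I_n _ _ (@ae_filter R) ti.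
  by apply: ae_imp => t h; apply/colP => i; rewrite !mxE.
Qed.

Lemma ker_toeplitz_closed : closed_subspace (ker_truncated_toeplitz theta G).
Proof.
split.
- by move=> X [KX _] i; case: (KX i).
- apply/ker_toeplitzP; have K0 : vec_of K (fun=> 0 : 'cV[C]_n).
    move=> i; rewrite (_ : coord _ i = fun=> 0); first exact: model_space0.
    by apply/funext => t; rewrite /coord mxE.
  split=> // i k Kk; apply: vinner_ae0; first exact: vec_model_L2.
    by apply: L2_row_adjoint; exact: (model_space_L2 htheta).
  by apply: aeW.
- move=> c X Y /ker_toeplitzP[KX hX] /ker_toeplitzP[KY hY]; apply/ker_toeplitzP.
  split=> [i|i k Kk].
    by rewrite coord_lin; exact: (model_space_lin htheta).
  have LZ := L2_row_adjoint i (model_space_L2 htheta Kk).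
  have := ip_lin Hn c (vec_model_L2 KX) (vec_model_L2 KY) LZ.
  by rewrite hX // hY // mulr0 addr0.
- move=> u X Mu LX uX; apply/ker_toeplitzP.
  have Ku m : vec_of K (u m) by case/ker_toeplitzP: (Mu m).
  have Lu m := vec_model_L2 (Ku m).
  split=> [i|i k Kk].
    apply: (model_space_closed htheta (u := fun m => coord (u m) i)) => //.
      by move=> m; exact: Ku.
    apply: (sqnorm_cvg_L2norm _).1; last exact: uX.
    by apply: nearW => m; apply: (ph_sub H); [exact: Lu | exact: LX].
  have LZ := L2_row_adjoint i (model_space_L2 htheta Kk).
  have cX := cvg_ip Hn Lu LX LZ ((vcvg_sqn Lu LX).1 uX).
  apply: ComplexField.Normc.eq0_normc.
  apply/eqP; rewrite -sqrf_eq0 eq_le sqr_ge0 andbT.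
  apply: (cvgr_to_ge cX); apply: nearW => m.
  by case/ker_toeplitzP: (Mu m) => _ -> //; rewrite sub0r normcN.
Qed.

End KernelDescription.
(** * Near invariance *)

Section NearInvariance.
Context {R : realType} {n : nat}.
Local Notation C := R[i].
Local Notation mu := (circle R).
Local Notation vfun := (R -> 'cV[C]_n).
Variables (theta : R -> C) (G : R -> 'M[C]_n).
Hypothesis htheta : inner_function theta.
Hypothesis hG : forall i j, Linf (fun t => G t i j).
Implicit Types (X Y : vfun) (f g k : R -> C).

Let H := @L2_prehilbert R.
Let Hn := @vinner_prehilbert R n.
Local Notation K := (model_space theta).
Local Notation M := (ker_truncated_toeplitz theta G).

(** The mean of the conjugation applied to [z k]: for [k] in the model space it
    vanishes exactly when [z k] stays there. *)
Definition exit_functional k : C :=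
  cintegral (fun t => conjc (cexpi t) * twist theta k t).

Lemma exit_functional_lin c f g : L2 f -> L2 g ->
  exit_functional (fun t => c * f t + g t) =
  conjc c * exit_functional f + exit_functional g.
Proof.
move=> Lf Lg; rewrite /exit_functional -cintegral_lin_L2.
- congr cintegral; apply/funext => t; rewrite /twist conjcD conjcM; ring.
- by apply: L2_cexpi_conj_mul; exact: L2_twist.
- by apply: L2_cexpi_conj_mul; exact: L2_twist.
Qed.

(** The kernel of the functional has codimension at most one; when the functional
    is 0 on the whole model space, [k1] is 0. *)
Lemma exit_vector : exists2 k1, K k1 & forall k, K k -> exists c k',
  [/\ K k', exit_functional k' = 0 & k = fun t => c * k1 t + k' t].
Proof.
have [[k0 [Kk0 k00]]|nk] := pselect (exists k, K k /\ exit_functional k <> 0).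
- have L0 := model_space_L2 htheta Kk0; exists k0 => // k Kk.
  have Lk := model_space_L2 htheta Kk.
  pose c := conjc (exit_functional k / exit_functional k0).
  exists c, (fun t => - c * k0 t + k t); split.
  + exact: (model_space_lin htheta).
  + have cN : conjc (- c) = - conjc c by exact: rmorphN.
    rewrite exit_functional_lin // cN /c conjcK mulNr divfK ?addNr //.
    exact/eqP.
  + by apply/funext => t; rewrite mulNr addrA addrN add0r.
- exists (fun=> 0); first exact: (model_space0 htheta).
  move=> k Kk; exists 0, k; split=> //.
    by apply: contrapT => k0; apply: nk; exists k.
  by apply/funext => t; rewrite mulr0 add0r.
Qed.

(** Orthogonality of [G X] is only asked to those [k] that stay in the model space
    under multiplication by the variable. *)
Definition almost_kernel X : Prop := vec_of K X /\
  forall i k, K k -> exit_functional k = 0 -> vinner X (row_adjoint G i k) = 0.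

Lemma ker_almost_kernel X : M X -> almost_kernel X.
Proof. by move=> /(ker_toeplitzP htheta hG)[KX hX]; split=> // i k Kk _; exact: hX. Qed.

Lemma almost_kernel_L2 X : almost_kernel X -> vec_of (@L2 R) X.
Proof. by case=> KX _; exact: (vec_model_L2 htheta). Qed.

Lemma almost_kernel_lin c X Y : almost_kernel X -> almost_kernel Y ->
  almost_kernel (fun t => c *: X t + Y t).
Proof.
move=> [KX hX] [KY hY]; split=> [i|i k Kk k0].
  by rewrite coord_lin; exact: (model_space_lin htheta).
have LZ := L2_row_adjoint hG i (model_space_L2 htheta Kk).
have := ip_lin Hn c (vec_model_L2 htheta KX) (vec_model_L2 htheta KY) LZ.
by rewrite hX // hY // mulr0 addr0.
Qed.

Lemma backward_shiftE X : vat0 X = 0 ->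
  backward_shift X = fun t => conjc (cexpi t) *: X t.
Proof. by move=> X0; apply/funext => t; rewrite /backward_shift X0 subr0 cexpiV. Qed.

(** Multiplication by [conj z] on the left of the pairing becomes multiplication by
    [z] on the right, which keeps [k] in the model space. *)
Lemma backward_shift_almost_kernel X : M X -> vat0 X = 0 ->
  almost_kernel (backward_shift X).
Proof.
move=> /(ker_toeplitzP htheta hG)[KX hX] X0; rewrite backward_shiftE //.
have cE i : coord (fun t => conjc (cexpi t) *: X t) i =
    fun t => conjc (cexpi t) * coord X i t.
  by apply/funext => t; rewrite /coord mxE.
split=> [i|i k Kk k0].
  rewrite cE; apply: (model_space_backshift htheta) => //.
  by rewrite -at0E; [move/colP/(_ i) : X0; rewrite !mxE | case: (KX i)].
rewrite -(hX i _ (model_space_shift htheta Kk k0)); apply: eq_bigr => j _.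
rewrite cE !coord_row_adjoint; congr cintegral; apply/funext => t.
by rewrite !conjcM !conjcK; ring.
Qed.

Lemma almost_kernel_ker k1 X : K k1 ->
  (forall k, K k -> exists c k',
    [/\ K k', exit_functional k' = 0 & k = fun t => c * k1 t + k' t]) ->
  almost_kernel X -> (forall i, vinner X (row_adjoint G i k1) = 0) -> M X.
Proof.
move=> Kk1 dec NX X1; have LX := almost_kernel_L2 NX; case: NX => KX hX.
apply/(ker_toeplitzP htheta hG); split=> // i k Kk.
have [c [k' [Kk' k'0 ->]]] := dec k Kk.
have L1 := L2_row_adjoint hG i (model_space_L2 htheta Kk1).
have L' := L2_row_adjoint hG i (model_space_L2 htheta Kk').
have -> : row_adjoint G i (fun t => c * k1 t + k' t) =
    (c *: (row_adjoint G i k1 : R -> 'cV[C]_n) + row_adjoint G i k').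
  apply/funext => t.
  rewrite -[RHS]/(c *: row_adjoint G i k1 t + row_adjoint G i k' t).
  by apply/colP => j; rewrite !mxE; ring.
by rewrite (ip_linr Hn c L1 L' LX) X1 hX // mulr0 addr0.
Qed.

Definition theta_vec (j : 'I_n) : vfun := fun t => theta t *: delta_mx j 0.

Lemma coord_theta_vec j i :
  coord (theta_vec j) i = fun t => (i == j)%:R * theta t.
Proof. by apply/funext => t; rewrite /coord !mxE eqxx andbT mulrC. Qed.

Lemma theta_vec_H2 j : vec_of (@H2 R) (theta_vec j).
Proof.
have Ht := H2_inner htheta; move=> i; rewrite coord_theta_vec.
rewrite (_ : (fun _ => _) = fun t => (i == j)%:R * theta t + 0 * theta t).
  have H0 : H2 (fun t => 0 * theta t).
    rewrite (_ : (fun _ => _) = circle_poly 0); first exact: H2_circle_poly.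
    by apply/funext => t; rewrite /circle_poly horner0 mul0r.
  exact: H2_lin.
by apply/funext => t; rewrite mul0r addr0.
Qed.

Lemma vec_H2_L2 X : vec_of (@H2 R) X -> vec_of (@L2 R) X.
Proof. by move=> HX i; exact: H2_L2. Qed.

Lemma vinner_theta_vec j X : vec_of (@L2 R) X ->
  vinner (theta_vec j) X = L2inner theta (coord X j).
Proof.
move=> LX; have Lt := H2_L2 (H2_inner htheta).
have ti i : L2inner (coord (theta_vec j) i) (coord X i) =
    (i == j)%:R * L2inner theta (coord X i).
  by rewrite coord_theta_vec; exact: (ip_scale H _ Lt (LX i)).
rewrite /vinner (bigD1 j) //= ti eqxx mul1r big1 ?addr0 // => i /negbTE ij.
by rewrite ti ij mul0r.
Qed.

Lemma theta_vec_orthonormal i j :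
  vinner (theta_vec i) (theta_vec j) = (i == j)%:R.
Proof.
have Lt := H2_L2 (H2_inner htheta).
rewrite vinner_theta_vec; last exact: vec_H2_L2 (theta_vec_H2 j).
rewrite coord_theta_vec (ip_conj H _ Lt); last first.
  by have := ph_scale H (i == j)%:R Lt.
have -> : L2inner (fun t => (i == j)%:R * theta t) theta =
   (i == j)%:R * L2inner theta theta by exact: (ip_scale H _ Lt Lt).
have -> : L2inner theta theta = 1; last by rewrite mulr1 rmorph_nat.
rewrite L2inner_sqnorm -(sqnorm_twist htheta Lt).
rewrite (_ : sqnorm _ = sqnorm (trig 0)).
  by rewrite -L2inner_sqnorm trig_orthonormal.
apply: sqnorm_ae; [|exact: L2_measurable (L2_twist htheta Lt) |
  exact: L2_measurable (L2_trig 0)].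
case: htheta => _; apply: ae_imp => t t1.
by rewrite /twist mulr_conjc t1 expr1n.
Qed.

(** The backward shift [S] of [X] is split as [S = p + (S - p)] with [p] its
    projection to the kernel; subtracting from [S - p] the right combination of the
    defect vectors leaves a remainder [r] that is again in the kernel. *)
Theorem ker_toeplitz_nearly_invariant : nearly_invariant_with_defect n M.
Proof.
have Mcl := ker_toeplitz_closed htheta hG; split=> //.
have [MH2 M0 Mlin Mcvg] := Mcl.
have ML X : M X -> vec_of (@L2 R) X by move=> /MH2; exact: vec_H2_L2.
have [k1 Kk1 dec] := exit_vector.
pose W : set vfun := [set X | almost_kernel X /\ forall Y, M Y -> vinner X Y = 0].
have WL : W `<=` vec_of (@L2 R) by move=> X [/almost_kernel_L2].
have WK X : W X -> vec_of K X by case=> -[].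
have Wlin c X Y : W X -> W Y -> W ((c *: X + Y : R -> 'cV[C]_n)).
  move=> WX WY; have [NX X0] := WX; have [NY Y0] := WY.
  split; first exact: almost_kernel_lin.
  by move=> Z MZ; rewrite (ip_lin Hn c (WL _ WX) (WL _ WY) (ML _ MZ)) X0 // Y0 // mulr0 addr0.
have W0 : W (fun=> 0).
  split; first exact: ker_almost_kernel.
  by move=> Y MY; apply: vinner_ae0; [exact: ML | exact: ML | exact: aeW].
have Lz i : vec_of (@L2 R) (row_adjoint G i k1).
  by apply: (L2_row_adjoint hG); exact: (model_space_L2 htheta).
have Le j := vec_H2_L2 (theta_vec_H2 j).
have Ke X j : vec_of K X -> vinner (theta_vec j) X = 0.
  move=> KX; rewrite vinner_theta_vec; last exact: (vec_model_L2 htheta).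
  exact: (inner_theta htheta).
have We X j : W X -> vinner X (theta_vec j) = 0.
  move=> WX; rewrite (ip_conj Hn (Le j) (WL _ WX)) Ke ?rmorph0 //.
  exact: WK.
have [u [uW ufree uspan]] := triangular_complement Hn WL (ex_intro _ _ W0) Wlin
  Lz Le theta_vec_orthonormal We.
have uH2 j : vec_of (@H2 R) (u j).
  case: (uW j) => [/WK Ku i|->]; last exact: theta_vec_H2.
  by case: (Ku i).
have uL j := vec_H2_L2 (uH2 j).
have sumE (c : 'I_n -> C) t :
    (\sum_(j < n) c j *: (u j : R -> 'cV[C]_n)) t = \sum_(j < n) c j *: u j t.
  by rewrite fct_sumE.
have sumL (c : 'I_n -> C) :
    vec_of (@L2 R) (\sum_(j < n) c j *: (u j : R -> 'cV[C]_n)).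
  exact: (ph_sum Hn _ (ML _ M0) uL).
exists [set X | vec_of (@H2 R) X /\ exists c : 'I_n -> C,
  {ae mu, forall t, X t = \sum_(j < n) c j *: u j t}]; split.
- exists u; split=> // c c0; apply: ufree => v Lv.
  apply: vinner_ae0 (sumL c) Lv _.
  by apply: (ae_imp _ c0) => t; rewrite sumE.
- move=> X Y MX [HY [c Yc]].
  have LX := ML _ MX; have LY := vec_H2_L2 HY.
  rewrite (ip_conj Hn LY LX) (_ : vinner Y X = 0) ?rmorph0 //.
  pose s : R -> 'cV[C]_n := \sum_(j < n) c j *: (u j : R -> 'cV[C]_n).
  have : vinner ((Y : R -> 'cV[C]_n) - s) X = 0.
    apply: vinner_ae0 (ph_sub Hn LY (sumL c)) LX _.
    apply: (ae_imp _ Yc) => t Yt.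
    by rewrite -[LHS]/(Y t - s t) Yt /s sumE subrr.
  rewrite (ip_sub Hn LY (sumL c) LX) => /eqP; rewrite subr_eq0 => /eqP ->.
  rewrite (ip_sum Hn _ LX uL) big1 // => j _.
  case: (uW j) => [[_ ->]|->]; rewrite ?mulr0 // Ke ?mulr0 //.
  by have [] := ker_almost_kernel MX.
- move=> X MX X0.
  have NS := backward_shift_almost_kernel MX X0.
  have LS := almost_kernel_L2 NS.
  have [p Mp orthp] := vec_L2_projection ML (ex_intro _ _ M0) Mlin Mcvg LS.
  set S := backward_shift X in NS LS orthp *.
  have Ww : W (fun t => S t - p t).
    split=> //.
    rewrite (_ : (fun _ => _) = fun t => -1 *: p t + S t).
      by apply: almost_kernel_lin => //; exact: ker_almost_kernel.
    by apply/funext => t; rewrite scaleN1r addrC.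
  have [c [Wr rz]] := uspan _ Ww.
  set r := _ - _ in Wr rz.
  have Mr : M r by apply: (almost_kernel_ker Kk1 dec) => //; case: Wr.
  exists (fun t => 1 *: p t + r t), (\sum_(j < n) c j *: (u j : R -> 'cV[C]_n)).
  split; first exact: Mlin.
    split; last by exists c; apply: aeW => t; rewrite sumE.
    move=> i.
    have -> : coord (\sum_(j < n) c j *: (u j : R -> 'cV[C]_n)) i =
        coord (fun t => (S t - p t) - r t) i.
      congr coord; apply/funext => t; rewrite /r.
      rewrite -[X in _ = _ - X]/(S t - p t - (\sum_(j < n) c j *: (u j : R -> 'cV[C]_n)) t).
      by rewrite opprB addrC subrK.
    have Kw := WK _ Ww i; have Kr := WK _ Wr i.
    rewrite coord_sub (_ : (fun _ => _) = fun t => -1 * coord r i t +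
      coord (fun t => S t - p t) i t).
      by have [] := model_space_lin htheta (-1) Kr Kw.
    by apply/funext => t; rewrite mulN1r addrC.
  apply: aeW => t; rewrite scale1r.
  rewrite -[r t]/(S t - p t - (\sum_(j < n) c j *: (u j : R -> 'cV[C]_n)) t).
  by rewrite -addrA subrK addrC subrK.
Qed.

End NearInvariance.

Theorem theorem5p2 (R : realType) (theta : R -> R[i]) (G : R -> 'M[R[i]]_2)
  (htheta : inner_function theta)
  (hG : forall i j, Linf (fun t => G t i j)) :
  nearly_invariant_with_defect 2 (ker_truncated_toeplitz theta G).
Proof. exact: ker_toeplitz_nearly_invariant. Qed.
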